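(* For every integer $n \geq 8$, $$\left(\Delta \bar{p}(n)\right)^2>\Delta \bar{p}(n-1)\,\Delta \bar{p}(n+1),$$ where $\bar{p}(n)$ is the number of overpartitions of $n$ and $\Delta \bar{p}(n)=\bar{p}(n+1)-\bar{p}(n)$.
   Context: A partition of a positive integer $n$ is a non-increasing sequence of positive integers with sum $n$. An overpartition of $n$ is a partition of $n$ in which the first occurrence of each distinct part may (or may not) be overlined; $\bar{p}(n)$ denotes the number of overpartitions of $n$. The first-order forward difference of a sequence $f(n)$ is $\Delta f(n)=f(n+1)-f(n)$. *)

(* Defs.v *)
From mathcomp Require Import all_boot all_order all_algebra.

Set Implicit Arguments.
Unset Strict Implicit.
Unset Printing Implicit Defensive.

Local Open Scope nat_scope.

(* A candidate overpartition is a sequence of pairs (part, overlined?). *)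
Definition parts (s : seq (nat * bool)) : seq nat := [seq x.1 | x <- s].

Definition is_partition (n : nat) (l : seq nat) : bool :=
  [&& sorted geq l, all (leq 1) l & sumn l == n].

(* Only the first occurrence of a part may be overlined. *)
Definition is_overpartition (n : nat) (s : seq (nat * bool)) : bool :=
  is_partition n (parts s) &&
  all (fun i => (nth (0, false) s i).2 ==>
                (nth 0 (parts s) i \notin take i (parts s)))
      (iota 0 (size s)).

(* The overpartitions of n are counted inside the finite type of sequences of
   length at most n with parts at most n; [ord_forget_inj] and
   [is_overpartition_bounded] show that this neither merges nor excludes any. *)
Definition ord_forget (n : nat) (s : seq ('I_n.+1 * bool)) : seq (nat * bool) :=
  [seq (nat_of_ord x.1, x.2) | x <- s].

Definition overpartitions (n : nat) : {set n.-bseq ('I_n.+1 * bool)} :=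
  [set s : n.-bseq ('I_n.+1 * bool) | is_overpartition n (ord_forget s)].

Definition pbar (n : nat) : nat := #|overpartitions n|.

Definition delta (f : nat -> nat) (n : nat) : int :=
  ((f n.+1)%:Z - (f n)%:Z)%R.

Lemma ord_forget_inj (n : nat) : injective (@ord_forget n).
Proof. by apply: inj_map => -[a b] [c d] [] /val_inj -> ->. Qed.

Lemma is_overpartition_bounded (n : nat) (s : seq (nat * bool)) :
  is_overpartition n s ->
  exists2 t : n.-bseq ('I_n.+1 * bool), t \in overpartitions n & ord_forget t = s.
Proof.
move=> Hs; case/andP: (Hs) => /and3P[_ Hpos /eqP Hsum] _.
have Hsz : size s <= n.
  rewrite -Hsum /parts; elim: s {Hs Hsum} Hpos => //= x s IH /andP[x0 /IH].
  by move=> H; rewrite -[(size s).+1]add1n leq_add.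
have Hle x : x \in s -> x.1 <= n.
  rewrite -Hsum /parts; elim: s {Hs Hpos Hsum Hsz} => //= y s IH.
  rewrite inE => /orP[/eqP-> | /IH H]; first exact: leq_addr.
  exact: leq_trans H (leq_addl _ _).
pose u : seq ('I_n.+1 * bool) := [seq (inord x.1, x.2) | x <- s].
have Hu : ord_forget u = s.
  rewrite /ord_forget /u -map_comp -[RHS]map_id; apply/eq_in_map => -[a b] /Hle /=.
  by move=> Ha; rewrite inordK.
have Hsu : size u <= n by rewrite size_map.
by exists (Bseq Hsu) => //; rewrite inE /= Hu.
Qed.

(* Main.v *)
(** Write F(q) = \prod_(m >= 1) (1 + q^m) / (1 - q^m) for the generating function of pbar and
    a(N) for the coefficient of q^N in (1 - q) F(q), so that a(N) = pbar(N) - pbar(N - 1).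
    By the inequality of arithmetic and geometric means, a(N)^2 > a(N-1) a(N+1) as soon as
    2 a(N) r^N > a(N-1) r^(N-1) + a(N+1) r^(N+1) for a single r in (0, 1).  Up to a positive
    factor the difference of the two sides is
      \int_0^pi Re (F(q) (1 - q) e^(- i N th)) (1 - cos th) d th,   q = r e^(i th).
    Take r = 1 / (1 + e) such that the phase of F(q) (1 - q) e^(- i N th) has derivative 0 at
    th = 0.  Then the phase is O(th^3 / e^4), so the integrand is nonnegative for
    th <= 1.42 e^(3/2), and its integral over th <= 0.86 e^(3/2) outweighs the rest, where F
    decays like a Gaussian up to th = e / 2 and is exponentially small beyond.  This works for
    N >= 3000 with F truncated to finitely many factors.  The remaining cases are computed with
    Gauss's recurrence pbar(n) = 2 (pbar(n - 1) - pbar(n - 4) + pbar(n - 9) - ...), which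
    follows from a finite form of 1 / F(q) = \sum_k (-1)^k q^(k^2). *)

(* Passing through the arithmetic-geometric mean makes the claim linear in the coefficients, so only
   the sign of one integral is needed and no asymptotic expansion of pbar with error terms.
   Truncation to K factors is exact, since pbar(n) involves no factor beyond the n-th; K can
   therefore be as large as N^4, and the only limit ever taken is in the degree J at which the power
   series is cut off. The width e^(3/2) is that of the Gaussian: near 0 the log-modulus drops like
   th^2 / e^3. On this scale th = y e^(3/2) the cubic phase is only about 3 y^3 e^(1/2), small for
   bounded y. The factor 1 - cos th, which is the second difference in N, vanishes at the saddle, so
   the main contribution is merely of order e^(9/2), and all other ranges have to be measured
   against that. The bound e <= 1/34 makes the resulting numerical comparison succeed. At e = 1/34
   the saddle equation is solved by some N < 3000, which gives the threshold. *)
From Stdlib Require Import Reals Ranalysis5 Lra Lia Psatz Arith ZArith List.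
From Coquelicot Require Import Coquelicot.

Open Scope R_scope.

(** * The Moebius factor (1 + z) / (1 - z) in polar form *)

(* At z = rho e^(i psi), the number (1 + z) / (1 - z) has modulus exp (logmod rho (cos psi))
   and argument phase rho (sin psi). *)
Definition logmod (rho c : R) : R :=
  / 2 * (ln (1 + 2 * rho * c + rho ^ 2) - ln (1 - 2 * rho * c + rho ^ 2)).
Definition phase (rho s : R) : R := atan (2 * rho * s / (1 - rho ^ 2)).

Lemma quad_pos (rho c : R) : 0 <= rho < 1 -> -1 <= c <= 1 -> 0 < 1 + 2 * rho * c + rho ^ 2.
Proof. intros; nra. Qed.

Lemma quad_pos' (rho c : R) : 0 <= rho < 1 -> -1 <= c <= 1 -> 0 < 1 - 2 * rho * c + rho ^ 2.
Proof. intros; nra. Qed.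

Lemma polar_cos_sin (X Y : R) : 0 < X ->
  sqrt (X ^ 2 + Y ^ 2) * cos (atan (Y / X)) = X /\
  sqrt (X ^ 2 + Y ^ 2) * sin (atan (Y / X)) = Y.
Proof.
intros HX.
assert (H : sqrt (1 + (Y / X)²) = sqrt (X ^ 2 + Y ^ 2) / X).
{ replace (1 + (Y / X)²) with ((X ^ 2 + Y ^ 2) / X ^ 2) by (unfold Rsqr; field; lra).
  rewrite sqrt_div_alt by nra. now rewrite sqrt_pow2 by lra. }
assert (0 < sqrt (X ^ 2 + Y ^ 2)) by (apply sqrt_lt_R0; nra).
rewrite cos_atan, sin_atan, H. split; field; lra.
Qed.

Lemma exp_half_ln (x : R) : 0 < x -> exp (/ 2 * ln x) = sqrt x.
Proof.
intros H. rewrite <- (exp_ln (sqrt x)) by now apply sqrt_lt_R0.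
f_equal. rewrite <- (sqrt_sqrt x) at 1 by lra.
rewrite ln_mult by now apply sqrt_lt_R0. field.
Qed.

(** The right-hand sides are the real and imaginary parts of (1 + z) / (1 - z) at z = rho e^(i psi).
    The real part is positive, so [atan] gives the correct argument. *)
Lemma moebius_polar (rho psi : R) : 0 <= rho < 1 ->
  exp (logmod rho (cos psi)) * cos (phase rho (sin psi)) =
    (1 - rho ^ 2) / (1 - 2 * rho * cos psi + rho ^ 2) /\
  exp (logmod rho (cos psi)) * sin (phase rho (sin psi)) =
    2 * rho * sin psi / (1 - 2 * rho * cos psi + rho ^ 2).
Proof.
intros Hr.
pose proof (COS_bound psi) as Hc. pose proof (sin2_cos2 psi) as Hsc. unfold Rsqr in Hsc.
pose proof (quad_pos rho (cos psi) Hr Hc) as H1.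
pose proof (quad_pos' rho (cos psi) Hr Hc) as H2.
set (D := 1 - 2 * rho * cos psi + rho ^ 2) in *.
set (E := 1 + 2 * rho * cos psi + rho ^ 2) in *.
assert (HE : exp (logmod rho (cos psi)) =
             sqrt (((1 - rho ^ 2) / D) ^ 2 + (2 * rho * sin psi / D) ^ 2)).
{ unfold logmod. fold D E. rewrite <- ln_div by lra.
  rewrite exp_half_ln by now apply Rdiv_lt_0_compat.
  f_equal. unfold D, E in *. apply (Rmult_eq_reg_r (D ^ 2)); [|unfold D; nra].
  unfold D. field_simplify; try lra.
  replace (sin psi ^ 2) with (1 - cos psi ^ 2) by nra. ring. }
assert (HX : 0 < (1 - rho ^ 2) / D) by (apply Rdiv_lt_0_compat; nra).
destruct (polar_cos_sin _ (2 * rho * sin psi / D) HX) as [P1 P2].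
unfold phase. rewrite HE.
replace (2 * rho * sin psi / D / ((1 - rho ^ 2) / D)) with (2 * rho * sin psi / (1 - rho ^ 2))
  in P1, P2 by (field; split; nra).
now split.
Qed.

(** Real part of e^(i x) w = e^(i x) (1 + z + z w), where w = (1 + z) / (1 - z); this has the shape
    of the recursion [b_S]. *)
Lemma moebius_rotation (rho psi x : R) : 0 <= rho < 1 ->
  exp (logmod rho (cos psi)) * cos (phase rho (sin psi) + x) =
  cos x + rho * cos (x + psi)
  + rho * (exp (logmod rho (cos psi)) * cos (phase rho (sin psi) + (x + psi))).
Proof.
intros Hr. destruct (moebius_polar rho psi Hr) as [P1 P2].
pose proof (COS_bound psi) as Hc. pose proof (sin2_cos2 psi) as Hsc. unfold Rsqr in Hsc.
pose proof (quad_pos' rho (cos psi) Hr Hc) as H2.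
set (M := exp _) in *. set (a := phase _ _) in *.
rewrite (cos_plus a x), (cos_plus a (x + psi)), !Rmult_minus_distr_l, <- !(Rmult_assoc M).
rewrite P1, P2, sin_plus, cos_plus.
set (D := 1 - 2 * rho * cos psi + rho ^ 2) in *.
apply (Rmult_eq_reg_r D); [|lra]. field_simplify; try lra.
unfold D. replace (sin psi ^ 2) with (1 - cos psi ^ 2) by nra. ring.
Qed.

(* In the power series of log ((1 + z) / (1 - z)) - 2 z the coefficients are nonnegative, so its
   real part is largest at z = rho; here this is read off the derivative in rho. *)
Lemma logmod_upper (rho c : R) : 0 <= rho < 1 -> -1 <= c <= 1 ->
  logmod rho c <= logmod rho 1 - 2 * rho * (1 - c).
Proof.
intros Hr Hc.
set (H := fun t => logmod t 1 - 2 * t * (1 - c) - logmod t c).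
assert (H0 : H 0 = 0).
{ unfold H, logmod. replace (1 + 2 * 0 * 1 + 0 ^ 2) with 1 by ring.
  replace (1 - 2 * 0 * 1 + 0 ^ 2) with 1 by ring.
  replace (1 + 2 * 0 * c + 0 ^ 2) with 1 by ring.
  replace (1 - 2 * 0 * c + 0 ^ 2) with 1 by ring. ring. }
set (dH := fun t => 2 / (1 - t ^ 2) - 2 * (1 - c)
                    - 2 * c * (1 - t ^ 2) / ((1 + t ^ 2) ^ 2 - 4 * t ^ 2 * c ^ 2)).
destruct (MVT_gen H 0 rho dH) as [t [Ht E]].
- intros t. rewrite Rmin_left, Rmax_right by lra. intros Ht.
  pose proof (quad_pos t c ltac:(lra) Hc). pose proof (quad_pos' t c ltac:(lra) Hc).
  pose proof (quad_pos t 1 ltac:(lra) ltac:(lra)). pose proof (quad_pos' t 1 ltac:(lra) ltac:(lra)).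
  unfold H, logmod, dH. auto_derive; [repeat split; nra|].
  field. repeat split; try nra.
- intros t. rewrite Rmin_left, Rmax_right by lra. intros Ht.
  apply continuity_pt_filterlim, (@ex_derive_continuous R_AbsRing R_NormedModule).
  pose proof (quad_pos t c ltac:(lra) Hc). pose proof (quad_pos' t c ltac:(lra) Hc).
  pose proof (quad_pos t 1 ltac:(lra) ltac:(lra)). pose proof (quad_pos' t 1 ltac:(lra) ltac:(lra)).
  unfold H, logmod. auto_derive; repeat split; nra.
- rewrite Rmin_left, Rmax_right in Ht by lra.
  enough (0 <= H rho) by (unfold H in *; lra).
  enough (0 <= dH t) by nra.
  set (u := t ^ 2). assert (Hu : 0 <= u < 1) by (unfold u; nra).
  unfold dH. fold u.
  set (P := (1 + u) ^ 2 - 4 * u * c ^ 2).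
  assert (HP : 0 < P).
  { unfold P. assert (c ^ 2 <= 1) by nra. nra. }
  replace (2 / (1 - u) - 2 * (1 - c) - 2 * c * (1 - u) / P)
    with (2 * u * (1 - c) * ((1 - u) * (2 * c + 1) ^ 2 + 2 * u * (2 * c + 1) + u + u ^ 2)
          / ((1 - u) * P)) by (unfold P; field; split; [exact (Rgt_not_eq _ _ HP)|lra]).
  apply Rdiv_le_0_compat; [|nra].
  assert (0 <= (1 - u) * (2 * c + 1) ^ 2 + 2 * u * (2 * c + 1) + u + u ^ 2).
  (* For c >= 0 every summand is nonnegative; otherwise 2 u (2 c + 1) may be negative, and
     completing a square leaves a product of nonnegative factors. *)
  { destruct (Rle_dec 0 c).
    - nra.
    - replace ((1 - u) * (2 * c + 1) ^ 2 + 2 * u * (2 * c + 1) + u + u ^ 2)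
        with (((1 - u) - (2 * c + 2)) ^ 2 + u * (2 * c + 2) * (- 2 * c)) by ring.
      assert (0 <= u * (2 * c + 2)) by nra.
      assert (0 <= u * (2 * c + 2) * (- 2 * c)) by (apply Rmult_le_pos; lra).
      pose proof (pow2_ge_0 (1 - u - (2 * c + 2))). lra. }
  assert (0 <= 2 * u * (1 - c)) by nra. nra.
Qed.

(** Mean value theorem in c: the derivative has denominator |1 - z^2|^2 = (1 - rho^2)^2 + 4 rho^2 (1
    - c^2), hence is largest at c = 1. *)
Lemma logmod_lower (rho c : R) : 0 <= rho < 1 -> -1 <= c <= 1 ->
  logmod rho 1 - (1 - c) * (2 * rho * (1 + rho ^ 2) / (1 - rho ^ 2) ^ 2) <= logmod rho c.
Proof.
intros Hr Hc.
set (dH := fun x => 2 * rho * (1 + rho ^ 2) / ((1 + 2 * rho * x + rho ^ 2) * (1 - 2 * rho * x + rho ^ 2))).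
destruct (MVT_gen (logmod rho) c 1 dH) as [x [Hx E]].
- intros x. rewrite Rmin_left, Rmax_right by lra. intros Hx.
  pose proof (quad_pos rho x Hr ltac:(lra)). pose proof (quad_pos' rho x Hr ltac:(lra)).
  unfold logmod, dH. auto_derive; [repeat split; nra|].
  field. repeat split; nra.
- intros x. rewrite Rmin_left, Rmax_right by lra. intros Hx.
  apply continuity_pt_filterlim, (@ex_derive_continuous R_AbsRing R_NormedModule).
  pose proof (quad_pos rho x Hr ltac:(lra)). pose proof (quad_pos' rho x Hr ltac:(lra)).
  unfold logmod. auto_derive; repeat split; nra.
- rewrite Rmin_left, Rmax_right in Hx by lra.
  enough (dH x <= 2 * rho * (1 + rho ^ 2) / (1 - rho ^ 2) ^ 2) by nra.
  unfold dH, Rdiv. apply Rmult_le_compat_l; [nra|].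
  apply Rinv_le_contravar; [apply pow_lt; nra|].
  replace ((1 + 2 * rho * x + rho ^ 2) * (1 - 2 * rho * x + rho ^ 2))
    with ((1 - rho ^ 2) ^ 2 + 4 * rho ^ 2 * (1 - x ^ 2)) by ring.
  assert (0 <= rho ^ 2 * (1 - x ^ 2)) by (apply Rmult_le_pos; nra). lra.
Qed.

(** * Polar form of the truncated generating function *)

Fixpoint sum1 (f : nat -> R) (K : nat) : R :=
  match K with O => 0 | S k => sum1 f k + f (S k) end.

Lemma sum1_le (f g : nat -> R) (K : nat) :
  (forall m, (1 <= m)%nat -> f m <= g m) -> sum1 f K <= sum1 g K.
Proof.
intros H. induction K; simpl; [lra|]. apply Rplus_le_compat; [exact IHK|apply H; lia].
Qed.

Lemma sum1_ext (f g : nat -> R) (K : nat) :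
  (forall m, (1 <= m)%nat -> f m = g m) -> sum1 f K = sum1 g K.
Proof.
intros H. induction K; simpl; [easy|]. rewrite IHK, H; [easy|lia].
Qed.

Lemma sum1_plus (f g : nat -> R) (K : nat) :
  sum1 (fun m => f m + g m) K = sum1 f K + sum1 g K.
Proof. induction K; simpl; lra. Qed.

Lemma sum1_scal (a : R) (f : nat -> R) (K : nat) :
  sum1 (fun m => a * f m) K = a * sum1 f K.
Proof. induction K; simpl; lra. Qed.

Definition total_logmod (r : R) (K : nat) (th : R) : R :=
  sum1 (fun m => logmod (r ^ m) (cos (INR m * th))) K.
Definition total_phase (r : R) (K : nat) (th : R) : R :=
  sum1 (fun m => phase (r ^ m) (sin (INR m * th))) K.

Lemma pow_range (r : R) (m : nat) : 0 < r < 1 -> (1 <= m)%nat -> 0 < r ^ m < 1.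
Proof.
intros Hr Hm. split; [apply pow_lt; lra|].
destruct m; [lia|]. simpl.
assert (0 < r ^ m) by (apply pow_lt; lra).
assert (r ^ m <= 1). { rewrite <- (pow1 m). apply pow_incr; lra. } nra.
Qed.

Lemma total_logmod_le_0 (r : R) (K : nat) (th : R) : 0 < r < 1 ->
  total_logmod r K th <= total_logmod r K 0.
Proof.
intros Hr. apply sum1_le. intros m Hm.
pose proof (pow_range r m Hr Hm) as H. pose proof (COS_bound (INR m * th)) as Hc.
rewrite Rmult_0_r, cos_0.
pose proof (logmod_upper (r ^ m) (cos (INR m * th)) ltac:(lra) ltac:(lra)).
assert (0 <= r ^ m * (1 - cos (INR m * th))) by (apply Rmult_le_pos; lra). lra.
Qed.

Lemma sum_shift (f : nat -> R) (m J : nat) :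
  sum_f_R0 (fun j => if (m <=? j)%nat then f (j - m)%nat else 0) J =
  if (m <=? J)%nat then sum_f_R0 f (J - m) else 0.
Proof.
induction J as [|J IH].
- cbn [sum_f_R0]. destruct m; reflexivity.
- rewrite tech5, IH.
  destruct (Nat.leb_spec m J) as [H|H]; destruct (Nat.leb_spec m (S J)) as [H'|H']; try lia.
  + replace (S J - m)%nat with (S (J - m)) by lia. now rewrite tech5.
  + replace (S J - m)%nat with O by lia. simpl. lra.
  + lra.
Qed.

Section Coefficients.

(* [b K j] is the coefficient of q^j in F_K(q) = \prod_(m <= K) (1 + q^m) / (1 - q^m). *)
Variable b : nat -> nat -> nat.
Hypothesis b_0 : forall j, b 0 j = if (j =? 0)%nat then 1%nat else 0%nat.
(** Coefficientwise form of (1 - q^(K+1)) F_(K+1) = (1 + q^(K+1)) F_K. *)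
Hypothesis b_S : forall K j, b (S K) j =
  (b K j + if (S K <=? j)%nat then b K (j - S K) + b (S K) (j - S K) else 0)%nat.

(** Real part of e^(i x) times F_K cut off after q^J, at q = r e^(i th). The free shift x absorbs
    multiplication by powers of q. *)
Definition trig_sum (r : R) (K J : nat) (th x : R) : R :=
  sum_f_R0 (fun j => INR (b K j) * r ^ j * cos (INR j * th + x)) J.

Lemma trig_sum_S (r : R) (K J : nat) (th x : R) :
  trig_sum r (S K) J th x = trig_sum r K J th x +
    if (S K <=? J)%nat then
      r ^ S K * (trig_sum r K (J - S K) th (x + INR (S K) * th) +
                 trig_sum r (S K) (J - S K) th (x + INR (S K) * th))
    else 0.
Proof.
set (G := fun i => r ^ S K * (INR (b K i) * r ^ i * cos (INR i * th + (x + INR (S K) * th)) +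
     INR (b (S K) i) * r ^ i * cos (INR i * th + (x + INR (S K) * th)))).
unfold trig_sum at 1.
rewrite (sum_eq _ (fun j => INR (b K j) * r ^ j * cos (INR j * th + x) +
  (fun i => if (S K <=? i)%nat then G (i - S K)%nat else 0) j)).
- rewrite (sum_plus _ (fun i => if (S K <=? i)%nat then G (i - S K)%nat else 0)), sum_shift.
  unfold trig_sum. f_equal.
  destruct (S K <=? J)%nat; [|easy].
  rewrite <- sum_plus, scal_sum. apply sum_eq. intros; unfold G; ring.
- intros j _. unfold G. rewrite b_S. destruct (Nat.leb_spec (S K) j) as [H|H].
  + rewrite !plus_INR.
    replace (r ^ j) with (r ^ S K * r ^ (j - S K)) by (rewrite <- pow_add; f_equal; lia).
    replace (INR (j - S K) * th + (x + INR (S K) * th)) with (INR j * th + x)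
      by (rewrite minus_INR by exact H; ring).
    ring.
  + rewrite Nat.add_0_r. ring.
Qed.

(** Replaces complex power series: the cut-off sums tend to the polar form of F_K, uniformly in th
    and x. Any t in (r, 1) could serve as rate: the recursion multiplies an error by r^m while t^J
    drops only by t^m, and r^m < t^m lets one constant survive the induction on J. *)
Lemma polar_expansion (r : R) (K : nat) : 0 < r < 1 ->
  exists C, 0 <= C /\ forall J th x,
  Rabs (trig_sum r K J th x - exp (total_logmod r K th) * cos (total_phase r K th + x))
  <= C * ((1 + r) / 2) ^ J.
Proof.
intros Hr. set (t := (1 + r) / 2). assert (Ht : r < t < 1) by (unfold t; lra).
induction K as [|K IH].
- exists 0. split; [lra|]. intros J th x.
  replace (trig_sum r 0 J th x) with (cos x).
  + unfold total_logmod, total_phase. simpl. rewrite exp_0, Rplus_0_l, Rmult_1_l.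
    rewrite Rminus_diag, Rabs_R0. lra.
  + symmetry. unfold trig_sum. induction J as [|J IH].
    * simpl. rewrite b_0. simpl. rewrite Rmult_0_l, Rplus_0_l. ring.
    * rewrite tech5, IH, b_0. simpl. ring.
- destruct IH as [C [HC IH]].
  set (m := S K). set (rho := r ^ m). set (s := t ^ m).
  assert (Hrho : 0 < rho < 1) by (apply pow_range; [lra|unfold m; lia]).
  assert (Hs : rho < s).
  { unfold rho, s, m. clear -Hr Ht. induction K as [|K IH].
    - simpl. lra.
    - change (r * r ^ S K < t * t ^ S K). apply Rmult_le_0_lt_compat; try lra.
      apply pow_le; lra. }
  set (Mx := exp (total_logmod r K 0)). set (Mx' := exp (total_logmod r m 0)).
  assert (HMx : 0 < Mx) by apply exp_pos. assert (HMx' : 0 < Mx') by apply exp_pos.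
  (* Chosen so that C + rho C / s + rho C' / s <= C'; the summand with Mx + Mx' covers J < m, where
     the shifted sums are empty but their limits are not 0. *)
  set (C' := (C + rho * C / s) / (1 - rho / s) + C + (Mx + Mx') / s).
  assert (Hrs : 0 < rho / s < 1).
  { split; [apply Rdiv_lt_0_compat; lra|]. apply (Rmult_lt_reg_r s); [lra|]. field_simplify; lra. }
  assert (H1 : 0 <= (C + rho * C / s) / (1 - rho / s)).
  { apply Rdiv_le_0_compat; [|lra]. replace (rho * C / s) with (rho / s * C) by (field; lra). nra. }
  assert (H2 : 0 <= (Mx + Mx') / s) by (apply Rdiv_le_0_compat; lra).
  exists C'. split; [unfold C'; lra|].
  intros J th. induction J as [J IHJ] using lt_wf_ind. intros x.
  change (trig_sum r m J th x) with (trig_sum r (S K) J th x).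
  rewrite trig_sum_S. fold m. fold rho.
  set (psi := INR m * th).
  change (total_logmod r m th) with (total_logmod r K th + logmod rho (cos psi)).
  change (total_phase r m th) with (total_phase r K th + phase rho (sin psi)).
  rewrite exp_plus, Rmult_assoc.
  replace (total_phase r K th + phase rho (sin psi) + x)
    with (phase rho (sin psi) + (total_phase r K th + x)) by ring.
  rewrite moebius_rotation by lra.
  set (A := total_phase r K th) in *. set (M := exp (total_logmod r K th)) in *.
  assert (HM : 0 < M <= Mx).
  { split; [apply exp_pos|]. destruct (total_logmod_le_0 r K th Hr) as [H|H].
    - left. now apply exp_increasing.
    - right. unfold M, Mx. now rewrite H. }
  assert (EM' : M * exp (logmod rho (cos psi)) = exp (total_logmod r m th)).
  { unfold M. rewrite <- exp_plus. reflexivity. }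
  assert (EA' : A + phase rho (sin psi) = total_phase r m th) by reflexivity.
  assert (HM' : 0 < exp (total_logmod r m th) <= Mx').
  { split; [apply exp_pos|]. destruct (total_logmod_le_0 r m th Hr) as [H|H].
    - left. now apply exp_increasing.
    - right. unfold Mx'. now rewrite H. }
  replace (M * (cos (A + x) + rho * cos (A + x + psi) +
      rho * (exp (logmod rho (cos psi)) * cos (phase rho (sin psi) + (A + x + psi)))))
    with (M * cos (A + x) + rho * (M * cos (A + (x + psi)) +
      exp (total_logmod r m th) * cos (total_phase r m th + (x + psi)))).
  2:{ rewrite <- EM', <- EA'. rewrite !Rmult_plus_distr_l, <- !Rmult_assoc.
      rewrite (Rmult_comm rho M), !Rplus_assoc.
      replace (phase rho (sin psi) + (A + (x + psi))) with (A + (phase rho (sin psi) + (x + psi))) by ring.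
      ring. }
  pose proof (IH J th x) as E1. fold A M in E1.
  destruct (Nat.leb_spec m J) as [HJ|HJ].
  + pose proof (IH (J - m)%nat th (x + psi)) as E2. fold A M in E2.
    pose proof (IHJ (J - m)%nat ltac:(unfold m in *; lia) (x + psi)) as E3.
    assert (EJ : t ^ J = s * t ^ (J - m)) by (unfold s; rewrite <- pow_add; f_equal; lia).
    rewrite EJ in *. set (q := t ^ (J - m)) in *.
    assert (Hq : 0 < q) by (apply pow_lt; lra).
    assert (HC' : C + rho * C / s + rho * C' / s <= C').
    { assert (C + rho * C / s <= C' * (1 - rho / s)).
      { unfold C'. rewrite 2!Rmult_plus_distr_r.
        replace ((C + rho * C / s) / (1 - rho / s) * (1 - rho / s)) with (C + rho * C / s)
          by (field; lra).
        assert (0 <= C * (1 - rho / s)) by nra.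
        assert (0 <= (Mx + Mx') / s * (1 - rho / s)) by nra. lra. }
      replace (rho * C' / s) with (C' * (rho / s)) by (field; lra). lra. }
    apply Rle_trans with ((C * s + rho * C + rho * C') * q).
    2:{ replace (C' * (s * q)) with (C' * s * q) by ring. apply Rmult_le_compat_r; [lra|].
        apply (Rmult_le_compat_r s) in HC'; [|lra].
        replace ((C + rho * C / s + rho * C' / s) * s) with (C * s + rho * C + rho * C') in HC'
          by (field; lra). exact HC'. }
    apply Rabs_le_between in E1. apply Rabs_le_between in E2. apply Rabs_le_between in E3.
    apply Rabs_le_between. split; nra.
  + assert (HtJ : s <= t ^ J).
    { unfold s. replace m with (J + (m - J))%nat by lia. rewrite pow_add.
      assert (0 < t ^ J) by (apply pow_lt; lra).
      assert (t ^ (m - J) <= 1). { rewrite <- (pow1 (m - J)). apply pow_incr; lra. } nra. }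
    set (c1 := cos (A + (x + psi))) in *. set (c2 := cos (total_phase r m th + (x + psi))) in *.
    assert (Hc1 : -1 <= c1 <= 1) by apply COS_bound.
    assert (Hc2 : -1 <= c2 <= 1) by apply COS_bound.
    assert (HMc : Rabs (rho * (M * c1 + exp (total_logmod r m th) * c2)) <= Mx + Mx').
    { assert (Rabs (M * c1) <= Mx) by (apply Rabs_le_between; split; nra).
      assert (Rabs (exp (total_logmod r m th) * c2) <= Mx') by (apply Rabs_le_between; split; nra).
      rewrite Rabs_mult, (Rabs_pos_eq rho) by lra.
      pose proof (Rabs_triang (M * c1) (exp (total_logmod r m th) * c2)).
      pose proof (Rabs_pos (M * c1 + exp (total_logmod r m th) * c2)). nra. }
    apply Rle_trans with (C * t ^ J + (Mx + Mx')).
    * apply Rabs_le_between in E1. apply Rabs_le_between in HMc. apply Rabs_le_between.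
      split; lra.
    * assert (Mx + Mx' <= (Mx + Mx') / s * t ^ J).
      { replace (Mx + Mx') with ((Mx + Mx') / s * s) at 1 by (field; lra).
        apply Rmult_le_compat_l; lra. }
      assert (0 <= (C + rho * C / s) / (1 - rho / s) * t ^ J) by (apply Rmult_le_pos; lra).
      unfold C'. lra.
Qed.

End Coefficients.

(** * Coefficient extraction *)

Lemma sin_Zpi (k : Z) : sin (IZR k * PI) = 0.
Proof. apply sin_eq_0_1. now exists k. Qed.

Definition half_period (k : Z) : R := if (k =? 0)%Z then PI else 0.

Lemma is_RInt_cos_int (k : Z) :
  is_RInt (fun t => cos (IZR k * t)) 0 PI (half_period k).
Proof.
unfold half_period. destruct (Z.eqb_spec k 0) as [->|Hk].
- apply (is_RInt_ext (fun _ => 1)).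
  + intros t _. now rewrite Rmult_0_l, cos_0.
  + replace PI with (scal (PI - 0) 1) at 2 by (unfold scal; simpl; unfold mult; simpl; ring).
    apply (@is_RInt_const R_NormedModule).
- assert (IZR k <> 0) by now apply not_0_IZR.
  set (F := fun t => sin (IZR k * t) / IZR k).
  replace 0 with (minus (F PI) (F 0)) at 2.
  + apply (@is_RInt_derive R_CompleteNormedModule).
    * intros t _. unfold F. auto_derive; [easy|]. field. easy.
    * intros t _. apply (@ex_derive_continuous R_AbsRing R_NormedModule). now auto_derive.
  + unfold F, minus, plus, opp; simpl. rewrite sin_Zpi, Rmult_0_r, sin_0. field. easy.
Qed.

(** As 1 - cos t = 1 - (e^(i t) + e^(-i t)) / 2, this is pi times the second-difference stencil
    (-1/2, 1, -1/2) around k = 0. *)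
Definition kernel_coef (k : Z) : R :=
  half_period k - / 2 * half_period (k + 1) - / 2 * half_period (k - 1).

Lemma is_RInt_kernel (k : Z) :
  is_RInt (fun t => cos (IZR k * t) * (1 - cos t)) 0 PI (kernel_coef k).
Proof.
apply (is_RInt_ext (fun t => minus (minus (cos (IZR k * t)) (scal (/ 2) (cos (IZR (k + 1) * t))))
                                   (scal (/ 2) (cos (IZR (k - 1) * t))))).
- intros t _. unfold minus, plus, opp, scal; simpl. unfold mult; simpl.
  rewrite plus_IZR, minus_IZR.
  replace ((IZR k + 1) * t) with (IZR k * t + t) by ring.
  replace ((IZR k - 1) * t) with (IZR k * t - t) by ring.
  rewrite cos_plus, cos_minus. field.
- apply (@is_RInt_minus R_NormedModule); [apply (@is_RInt_minus R_NormedModule)|].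
  + apply is_RInt_cos_int.
  + apply (@is_RInt_scal R_NormedModule), is_RInt_cos_int.
  + apply (@is_RInt_scal R_NormedModule), is_RInt_cos_int.
Qed.

(* Re (F_K(q) (1 - q) e^(- i N th)) (1 - cos th), with F_K cut off after q^J *)
Definition integrand (b : nat -> nat -> nat) (r : R) (K J N : nat) (th : R) : R :=
  (trig_sum b r K J th (- (INR N * th)) - r * trig_sum b r K J th (th - INR N * th)) * (1 - cos th).

Lemma is_RInt_integrand_sum (b : nat -> nat -> nat) (r : R) (K J N : nat) :
  is_RInt (integrand b r K J N) 0 PI
    (sum_f_R0 (fun j => INR (b K j) * r ^ j *
       (kernel_coef (Z.of_nat j - Z.of_nat N) - r * kernel_coef (Z.of_nat j + 1 - Z.of_nat N))) J).
Proof.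
assert (H : forall j, is_RInt (fun th => (INR (b K j) * r ^ j * cos (INR j * th + - (INR N * th))
    - r * (INR (b K j) * r ^ j * cos (INR j * th + (th - INR N * th)))) * (1 - cos th)) 0 PI
  (INR (b K j) * r ^ j *
       (kernel_coef (Z.of_nat j - Z.of_nat N) - r * kernel_coef (Z.of_nat j + 1 - Z.of_nat N)))).
{ intros j.
  apply (is_RInt_ext (fun th => scal (INR (b K j) * r ^ j)
     (minus (cos (IZR (Z.of_nat j - Z.of_nat N) * th) * (1 - cos th))
       (scal r (cos (IZR (Z.of_nat j + 1 - Z.of_nat N) * th) * (1 - cos th)))))).
  - intros th _. unfold minus, plus, opp, scal; simpl. unfold mult; simpl.
    rewrite !minus_IZR, plus_IZR, <- !INR_IZR_INZ.
    replace ((INR j - INR N) * th) with (INR j * th + - (INR N * th)) by ring.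
    replace ((INR j + 1 - INR N) * th) with (INR j * th + (th - INR N * th)) by ring. ring.
  - apply (@is_RInt_scal R_NormedModule), (@is_RInt_minus R_NormedModule);
      [|apply (@is_RInt_scal R_NormedModule)]; apply is_RInt_kernel. }
induction J as [|J IH].
- exact (H 0%nat).
- rewrite tech5. eapply is_RInt_ext; [|apply (@is_RInt_plus R_NormedModule); [exact IH|exact (H (S J))]].
  intros th _. unfold integrand, trig_sum. rewrite !tech5. unfold plus; simpl. ring.
Qed.

(** N is written M + 2 so that the four coefficients that survive, M to M + 3, need no truncated
    subtraction. *)
Lemma is_RInt_integrand (b : nat -> nat -> nat) (r : R) (K J M : nat) : (M + 3 <= J)%nat ->
  is_RInt (integrand b r K J (S (S M))) 0 PI
    (PI * ((INR (b K (S (S M))) - INR (b K (S M))) * r ^ S (S M)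
           - / 2 * ((INR (b K (S (S (S M)))) - INR (b K (S (S M)))) * r ^ S (S (S M)))
           - / 2 * ((INR (b K (S M)) - INR (b K M)) * r ^ S M))).
Proof.
intros HJ.
match goal with |- is_RInt _ _ _ ?v => set (V := v) end.
pose proof (is_RInt_integrand_sum b r K J (S (S M))) as H.
set (f := fun j : nat => _) in H.
assert (Hz : forall j, (j < M \/ M + 3 < j)%nat -> f j = 0).
{ intros j Hj. unfold f, kernel_coef, half_period.
  repeat match goal with |- context [(?x =? 0)%Z] => destruct (Z.eqb_spec x 0); [lia|] end. ring. }
assert (HV : sum_f_R0 f J = V); [|now rewrite <- HV].
replace J with (M + 3 + (J - (M + 3)))%nat by lia.
induction (J - (M + 3))%nat as [|d IH].
- rewrite Nat.add_0_r. replace (M + 3)%nat with (S (S (S M))) by lia. rewrite !tech5.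
  assert (HM : sum_f_R0 f M = f M).
  { assert (forall k, (k < M)%nat -> sum_f_R0 f k = 0).
    { induction k as [|k IHk]; intros Hk; [apply Hz; lia|].
      rewrite tech5, IHk by lia. rewrite Hz by lia. ring. }
    destruct M as [|M]; [easy|]. rewrite tech5, H0 by lia. ring. }
  rewrite HM. unfold f, kernel_coef, half_period, V.
  repeat match goal with |- context [(?x =? 0)%Z] => destruct (Z.eqb_spec x 0); try lia end.
  simpl pow. ring.
- rewrite Nat.add_succ_r, tech5, IH, Hz by lia. ring.
Qed.

(** |1 - q|^2 at q = r e^(i th). *)
Definition chord_sq (r th : R) : R := 1 - 2 * r * cos th + r ^ 2.

(** The argument of F_K(q) (1 - q) e^(- i N th); the last term is arg (1 - q). *)
Definition saddle_phase (r : R) (K N : nat) (th : R) : R :=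
  total_phase r K th - INR N * th - atan (r * sin th / (1 - r * cos th)).

Definition limit_integrand (r : R) (K N : nat) (th : R) : R :=
  exp (total_logmod r K th) * sqrt (chord_sq r th) * cos (saddle_phase r K N th) * (1 - cos th).

Lemma one_sub_q_polar (r th x : R) : 0 < r < 1 ->
  cos x - r * cos (x + th) = sqrt (chord_sq r th) * cos (x - atan (r * sin th / (1 - r * cos th))).
Proof.
intros Hr. pose proof (COS_bound th) as Hc. pose proof (sin2_cos2 th) as Hsc. unfold Rsqr in Hsc.
assert (HX : 0 < 1 - r * cos th) by nra.
destruct (polar_cos_sin (1 - r * cos th) (- (r * sin th)) HX) as [P1 P2].
replace ((1 - r * cos th) ^ 2 + (- (r * sin th)) ^ 2) with (chord_sq r th) in P1, P2.
2:{ unfold chord_sq. replace ((- (r * sin th)) ^ 2) with (r ^ 2 * (sin th * sin th)) by ring.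
    replace (sin th * sin th) with (1 - cos th * cos th) by lra. ring. }
replace (- (r * sin th) / (1 - r * cos th)) with (- (r * sin th / (1 - r * cos th)))
  in P1, P2 by (field; lra).
rewrite atan_opp in P1, P2.
unfold Rminus at 2. rewrite (cos_plus x (- _)), Rmult_minus_distr_l, cos_plus.
rewrite <- !Rmult_assoc, (Rmult_comm _ (cos x)), (Rmult_comm _ (sin x)), !Rmult_assoc, P1, P2. ring.
Qed.

Lemma continuous_sum1 (f : nat -> R -> R) (K : nat) (x : R) :
  (forall m, (1 <= m)%nat -> continuous (f m) x) -> continuous (fun t => sum1 (fun m => f m t) K) x.
Proof.
intros H. induction K; simpl.
- apply continuous_const.
- apply (@continuous_plus R_UniformSpace R_AbsRing R_NormedModule); [exact IHK|apply H; lia].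
Qed.

Lemma continuous_limit_integrand (r : R) (K N : nat) (th : R) : 0 < r < 1 ->
  continuous (limit_integrand r K N) th.
Proof.
intros Hr.
assert (C1 : continuous (total_logmod r K) th).
{ apply (continuous_sum1 (fun m t => logmod (r ^ m) (cos (INR m * t)))). intros m Hm.
  pose proof (pow_range r m Hr Hm) as Hp. pose proof (COS_bound (INR m * th)) as Hc.
  apply (@ex_derive_continuous R_AbsRing R_NormedModule). unfold logmod.
  set (p := r ^ m) in *.
  pose proof (quad_pos p _ ltac:(lra) Hc). pose proof (quad_pos' p _ ltac:(lra) Hc).
  auto_derive. split; [|split; [|easy]]; lra. }
assert (C2 : continuous (total_phase r K) th).
{ apply (continuous_sum1 (fun m t => phase (r ^ m) (sin (INR m * t)))). intros m Hm.
  apply (@ex_derive_continuous R_AbsRing R_NormedModule). unfold phase. now auto_derive. }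
pose proof (COS_bound th) as Hc.
unfold limit_integrand.
apply (@continuous_mult R_UniformSpace R_AbsRing).
2:{ apply (@ex_derive_continuous R_AbsRing R_NormedModule). now auto_derive. }
apply (@continuous_mult R_UniformSpace R_AbsRing).
- apply (@continuous_mult R_UniformSpace R_AbsRing).
  + apply (continuous_comp (total_logmod r K) exp); [exact C1|].
    apply (@ex_derive_continuous R_AbsRing R_NormedModule). now auto_derive.
  + apply (@ex_derive_continuous R_AbsRing R_NormedModule). unfold chord_sq. auto_derive. nra.
- apply (continuous_comp (saddle_phase r K N) cos).
  + unfold saddle_phase.
    apply (@continuous_minus R_UniformSpace R_AbsRing R_NormedModule).
    * apply (@continuous_minus R_UniformSpace R_AbsRing R_NormedModule); [exact C2|].
      apply (@ex_derive_continuous R_AbsRing R_NormedModule). now auto_derive.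
    * apply (@ex_derive_continuous R_AbsRing R_NormedModule). auto_derive. nra.
  + apply (@ex_derive_continuous R_AbsRing R_NormedModule). now auto_derive.
Qed.

Lemma ex_RInt_limit_integrand (r : R) (K N : nat) (x y : R) : 0 < r < 1 ->
  ex_RInt (limit_integrand r K N) x y.
Proof.
intros Hr. apply (@ex_RInt_continuous R_CompleteNormedModule).
intros t _. now apply continuous_limit_integrand.
Qed.

(** * From a positive limit integral to log-concavity of the differences *)

Section Criterion.

Variable b : nat -> nat -> nat.
Hypothesis b_0 : forall j, b 0 j = if (j =? 0)%nat then 1%nat else 0%nat.
Hypothesis b_S : forall K j, b (S K) j =
  (b K j + if (S K <=? j)%nat then b K (j - S K) + b (S K) (j - S K) else 0)%nat.

(** The factor 1 / (1 - q) is present from F_1 on, hence [S K]. The differences must be nonnegative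
    for the arithmetic-geometric mean step. *)
Lemma b_monotone (K j : nat) : (b (S K) j <= b (S K) (S j))%nat.
Proof.
revert j. induction K as [|K IHK].
- intros j. rewrite (b_S 0 (S j)). simpl. rewrite Nat.sub_0_r. lia.
- induction j as [j IH] using lt_wf_ind.
  rewrite (b_S (S K) j), (b_S (S K) (S j)). specialize (IHK).
  pose proof (IHK j).
  destruct (Nat.leb_spec (S (S K)) j) as [H1|H1]; destruct (Nat.leb_spec (S (S K)) (S j)) as [H2|H2]; try lia.
  pose proof (IHK (j - S (S K))%nat). pose proof (IH (j - S (S K))%nat ltac:(lia)).
  replace (S j - S (S K))%nat with (S (j - S (S K))) by lia. lia.
Qed.

Lemma integrand_near_limit (r : R) (K N : nat) : 0 < r < 1 ->
  exists C, 0 <= C /\ forall J th,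
    limit_integrand r K N th - integrand b r K J N th <= C * ((1 + r) / 2) ^ J.
Proof.
intros Hr. destruct (polar_expansion b b_0 b_S r K Hr) as [C [HC H]].
exists (4 * C). split; [lra|]. intros J th.
set (q := C * ((1 + r) / 2) ^ J) in *.
assert (Hq : 0 <= q) by (apply Rmult_le_pos; [easy|apply pow_le; lra]).
pose proof (H J th (- (INR N * th))) as H1. pose proof (H J th (th - INR N * th)) as H2.
unfold limit_integrand, integrand, saddle_phase.
rewrite (Rmult_assoc (exp _)), <- one_sub_q_polar by easy.
replace (total_phase r K th - INR N * th + th) with (total_phase r K th + (th - INR N * th)) by ring.
change (total_phase r K th - INR N * th) with (total_phase r K th + - (INR N * th)).
set (M := exp _) in *. set (T1 := trig_sum _ _ _ _ _ _) in *. set (c1 := cos (_ + _)) in *.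
set (T2 := trig_sum _ _ _ _ _ (th - _)) in *. set (c2 := cos (_ + (_ - _))) in *.
apply Rabs_le_between in H1. apply Rabs_le_between in H2. fold q in H1, H2.
pose proof (COS_bound th).
replace (M * (c1 - r * c2) * (1 - cos th) - (T1 - r * T2) * (1 - cos th))
  with ((- (T1 - M * c1) + r * (T2 - M * c2)) * (1 - cos th)) by ring.
replace (4 * C * ((1 + r) / 2) ^ J) with (4 * q) by (unfold q; ring).
set (u := T1 - M * c1) in *. set (v := T2 - M * c2) in *.
assert (Hu : - u + r * v <= 2 * q).
{ assert (0 <= r * (q - v)) by (apply Rmult_le_pos; lra).
  assert (0 <= (1 - r) * q) by (apply Rmult_le_pos; lra). lra. }
assert (0 <= (2 * q - (- u + r * v)) * (1 - cos th)) by (apply Rmult_le_pos; lra).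
assert (0 <= q * (1 + cos th)) by (apply Rmult_le_pos; lra). lra.
Qed.

(** The exact integral V of the cut-off integrand falls short of the limit integral by at most pi C
    ((1 + r) / 2)^J, so a large J makes V positive. In the product of the outer terms the powers of
    r combine to (r^N)^2 and cancel. *)
Lemma log_concave_of_integral_pos (r : R) (K M : nat) : 0 < r < 1 ->
  0 < RInt (limit_integrand r (S K) (S (S M))) 0 PI ->
  (INR (b (S K) (S M)) - INR (b (S K) M)) * (INR (b (S K) (S (S (S M)))) - INR (b (S K) (S (S M)))) <
  (INR (b (S K) (S (S M))) - INR (b (S K) (S M))) ^ 2.
Proof.
intros Hr HI.
destruct (integrand_near_limit r (S K) (S (S M)) Hr) as [C [HC H]].
set (a1 := INR (b (S K) (S (S (S M)))) - INR (b (S K) (S (S M)))).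
set (a := INR (b (S K) (S (S M))) - INR (b (S K) (S M))).
set (a0 := INR (b (S K) (S M)) - INR (b (S K) M)).
assert (Ha : 0 <= a0 /\ 0 <= a1).
{ split; [unfold a0|unfold a1]; apply Rge_le, Rge_minus, Rle_ge, le_INR, b_monotone. }
set (V := PI * (a * r ^ S (S M) - / 2 * (a1 * r ^ S (S (S M))) - / 2 * (a0 * r ^ S M))).
assert (HV : 0 < V).
{ set (I := RInt _ _ _) in HI.
  assert (Hlim : exists J, (M + 3 <= J)%nat /\ PI * (C * ((1 + r) / 2) ^ J) < I).
  { pose proof PI_RGT_0 as Hpi.
    destruct (pow_lt_1_zero ((1 + r) / 2) ltac:(rewrite Rabs_pos_eq; lra) (I / (PI * (C + 1))))
      as [J0 HJ0].
    { apply Rdiv_lt_0_compat; [easy|]. apply Rmult_lt_0_compat; lra. }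
    exists (J0 + (M + 3))%nat. split; [lia|].
    specialize (HJ0 (J0 + (M + 3))%nat ltac:(lia)).
    set (z := ((1 + r) / 2) ^ (J0 + (M + 3))) in *.
    assert (Hz : 0 < z) by (apply pow_lt; lra). rewrite Rabs_pos_eq in HJ0 by lra.
    apply (Rmult_lt_compat_r (PI * (C + 1))) in HJ0; [|apply Rmult_lt_0_compat; lra].
    assert (E : forall x y : R, y <> 0 -> x / y * y = x) by (intros; field; easy).
    rewrite E in HJ0 by (apply Rgt_not_eq, Rmult_lt_0_compat; lra).
    assert (0 < PI * z) by now apply Rmult_lt_0_compat. nra. }
  destruct Hlim as [J [HJ HC']].
  pose proof (is_RInt_integrand b r (S K) J M HJ) as HJI. fold a a1 a0 V in HJI.
  assert (HD : RInt (fun t => minus (limit_integrand r (S K) (S (S M)) t)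
                                    (integrand b r (S K) J (S (S M)) t)) 0 PI
               <= RInt (fun _ => C * ((1 + r) / 2) ^ J) 0 PI).
  { pose proof PI_RGT_0. apply RInt_le; [lra| | |].
    - apply (@ex_RInt_minus R_NormedModule); [now apply ex_RInt_limit_integrand|now exists V].
    - apply (@ex_RInt_const R_NormedModule).
    - intros t _. apply H. }
  rewrite RInt_const in HD. unfold scal in HD; simpl in HD; unfold mult in HD; simpl in HD.
  rewrite (@RInt_minus R_CompleteNormedModule) in HD;
    [|now apply ex_RInt_limit_integrand|now exists V].
  rewrite (is_RInt_unique _ _ _ _ HJI) in HD. fold I in HD.
  unfold minus, plus, opp in HD; simpl in HD. lra. }
unfold V in HV. pose proof PI_RGT_0.
set (u := a1 * r ^ S (S (S M))) in *. set (v := a0 * r ^ S M) in *. set (w := a * r ^ S (S M)) in *.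
assert (Hw : u + v < 2 * w).
{ assert (0 < w - / 2 * u - / 2 * v) by (apply (Rmult_lt_reg_l PI); lra). lra. }
assert (Hu : 0 <= u) by (apply Rmult_le_pos; [easy|apply pow_le; lra]).
assert (Hv : 0 <= v) by (apply Rmult_le_pos; [easy|apply pow_le; lra]).
assert (Huv : v * u < w ^ 2).
{ assert (0 < (2 * w - (u + v)) * (2 * w + (u + v))) by (apply Rmult_lt_0_compat; lra).
  pose proof (pow2_ge_0 (u - v)). lra. }
assert (Hrr : 0 < (r ^ S (S M)) ^ 2) by (apply pow_lt, pow_lt; lra).
apply (Rmult_lt_reg_r ((r ^ S (S M)) ^ 2)); [easy|].
replace (a0 * a1 * (r ^ S (S M)) ^ 2) with (v * u) by (unfold u, v; simpl; ring).
replace (a ^ 2 * (r ^ S (S M)) ^ 2) with (w ^ 2) by (unfold w; ring). exact Huv.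
Qed.

End Criterion.

(** * Sums over the factors at radius 1 / (1 + e) *)

(** In this and the next three lemmas the partial sum of m^j (1 + x)^(-m) is the value of the
    infinite series minus (1 + x)^(-K) times a polynomial in K with nonnegative coefficients. *)
Lemma geom_sum_0 (x : R) (K : nat) : 0 < x ->
  sum1 (fun m => (/ (1 + x)) ^ m) K <= / x.
Proof.
intros Hx.
assert (E : sum1 (fun m => (/ (1 + x)) ^ m) K = (1 - (/ (1 + x)) ^ K) / x).
{ induction K as [|K IH]; simpl sum1; [simpl; field; lra|].
  rewrite IH. simpl. field. lra. }
assert (0 <= (/ (1 + x)) ^ K) by (apply pow_le; left; apply Rinv_0_lt_compat; lra).
rewrite E. unfold Rdiv. assert (0 < / x) by now apply Rinv_0_lt_compat. nra.
Qed.

Lemma geom_sum_1 (x : R) (K : nat) : 0 < x ->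
  sum1 (fun m => INR m * (/ (1 + x)) ^ m) K <= (1 + x) / x ^ 2.
Proof.
intros Hx.
assert (E : sum1 (fun m => INR m * (/ (1 + x)) ^ m) K =
  (1 + x) / x ^ 2 - (/ (1 + x)) ^ K * ((1 + x) / x ^ 2 + INR K / x)).
{ induction K as [|K IH]; [simpl; field; lra|].
  cbn [sum1]. rewrite IH, S_INR. cbn [pow]. field. lra. }
assert (0 <= (/ (1 + x)) ^ K) by (apply pow_le; left; apply Rinv_0_lt_compat; lra).
assert (0 < / x) by now apply Rinv_0_lt_compat.
assert (0 < / x ^ 2) by (apply Rinv_0_lt_compat, pow_lt; lra).
pose proof (pos_INR K).
rewrite E. unfold Rdiv.
assert (0 <= (/ (1 + x)) ^ K * ((1 + x) * / x ^ 2 + INR K * / x)); [|lra].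
apply Rmult_le_pos; [easy|]. apply Rplus_le_le_0_compat; apply Rmult_le_pos; lra.
Qed.

Lemma geom_sum_2 (x : R) (K : nat) : 0 < x ->
  sum1 (fun m => INR m ^ 2 * (/ (1 + x)) ^ m) K <= (1 + x) * (2 + x) / x ^ 3.
Proof.
intros Hx.
assert (E : sum1 (fun m => INR m ^ 2 * (/ (1 + x)) ^ m) K =
  (1 + x) * (2 + x) / x ^ 3 - (/ (1 + x)) ^ K *
    ((1 + x) * (2 + x) / x ^ 3 + 2 * INR K * (1 + x) / x ^ 2 + INR K ^ 2 / x)).
{ induction K as [|K IH]; [simpl; field; lra|].
  cbn [sum1]. rewrite IH, S_INR. cbn [pow]. field. lra. }
assert (0 <= (/ (1 + x)) ^ K) by (apply pow_le; left; apply Rinv_0_lt_compat; lra).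
assert (0 < / x) by now apply Rinv_0_lt_compat.
assert (0 < / x ^ 2) by (apply Rinv_0_lt_compat, pow_lt; lra).
assert (0 < / x ^ 3) by (apply Rinv_0_lt_compat, pow_lt; lra).
pose proof (pos_INR K).
rewrite E. unfold Rdiv.
match goal with |- ?a - ?c <= _ => assert (0 <= c); [|lra] end.
apply Rmult_le_pos; [easy|].
repeat apply Rplus_le_le_0_compat; repeat apply Rmult_le_pos; try lra.
Qed.

Lemma geom_sum_3 (x : R) (K : nat) : 0 < x ->
  sum1 (fun m => INR m ^ 3 * (/ (1 + x)) ^ m) K <= (1 + x) * (6 + 6 * x + x ^ 2) / x ^ 4.
Proof.
intros Hx.
assert (E : sum1 (fun m => INR m ^ 3 * (/ (1 + x)) ^ m) K =
  (1 + x) * (6 + 6 * x + x ^ 2) / x ^ 4 - (/ (1 + x)) ^ K *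
    ((1 + x) * (6 + 6 * x + x ^ 2) / x ^ 4 + 3 * INR K * ((1 + x) * (2 + x)) / x ^ 3
      + 3 * INR K ^ 2 * (1 + x) / x ^ 2 + INR K ^ 3 / x)).
{ induction K as [|K IH]; [simpl; field; lra|].
  cbn [sum1]. rewrite IH, S_INR. cbn [pow]. field. lra. }
assert (0 <= (/ (1 + x)) ^ K) by (apply pow_le; left; apply Rinv_0_lt_compat; lra).
assert (0 < / x) by now apply Rinv_0_lt_compat.
assert (0 < / x ^ 2) by (apply Rinv_0_lt_compat, pow_lt; lra).
assert (0 < / x ^ 3) by (apply Rinv_0_lt_compat, pow_lt; lra).
assert (0 < / x ^ 4) by (apply Rinv_0_lt_compat, pow_lt; lra).
pose proof (pos_INR K).
rewrite E. unfold Rdiv.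
match goal with |- ?a - ?c <= _ => assert (0 <= c); [|lra] end.
apply Rmult_le_pos; [easy|].
repeat apply Rplus_le_le_0_compat; repeat apply Rmult_le_pos; try lra; nra.
Qed.

(* With 1 / (1 + e) = e^(-t) this is sinh t, and [slope] below is m / sinh (m t). *)
Definition sh (e : R) : R := e * (2 + e) / (2 * (1 + e)).

Definition slope (r : R) (m : nat) : R := 2 * INR m * r ^ m / (1 - (r ^ m) ^ 2).

Lemma inv_sh_le (e : R) : 0 < e -> 0 < / sh e <= (1 + e / 2) / e.
Proof.
intros He. unfold sh. split.
- apply Rinv_0_lt_compat. apply Rdiv_lt_0_compat; nra.
- apply (Rmult_le_reg_r (e * (2 + e))); [nra|]. field_simplify; [nra|lra|lra].
Qed.

Definition radius (e : R) : R := / (1 + e).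

Section Slope.

Variable e : R.
Hypothesis He : 0 < e.
Local Notation r := (radius e).

Lemma radius_range : 0 < r < 1.
Proof.
unfold radius. split; [apply Rinv_0_lt_compat; lra|].
rewrite <- Rinv_1. apply Rinv_lt_contravar; lra.
Qed.

(** With r = e^(-t) this is m sinh t <= sinh (m t), multiplied by 2 e^(-m t). *)
Lemma one_sub_pow_sq_ge (m : nat) : 2 * INR m * sh e * r ^ m <= 1 - (r ^ m) ^ 2.
Proof.
assert (H : forall m, INR m * (2 * sh e) <= (1 + e) ^ m - / (1 + e) ^ m).
{ induction m0 as [|m0 IH]; [simpl; lra|].
  rewrite S_INR. cbn [pow]. set (p := (1 + e) ^ m0) in *.
  assert (Hp : 1 <= p) by (apply pow_R1_Rle; lra).
  assert (Hq : p * / p = 1) by (apply Rinv_r; lra). set (q := / p) in *.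
  rewrite Rinv_mult. fold q.
  assert (Hz : (1 + e) * / (1 + e) = 1) by (apply Rinv_r; lra).
  assert (E2 : 2 * sh e = (1 + e) - / (1 + e)) by (unfold sh; field; lra).
  rewrite E2 in *. set (z := / (1 + e)) in *.
  assert (0 < z < 1) by (apply radius_range).
  assert (0 < q) by (apply Rinv_0_lt_compat; lra).
  assert (2 <= 1 + e + z) by nra. assert (2 <= p + q) by nra.
  assert (0 <= p - q) by nra.
  nra. }
specialize (H m). unfold radius. rewrite pow_inv. set (p := (1 + e) ^ m) in *.
assert (Hp : 1 <= p) by (apply pow_R1_Rle; lra).
apply (Rmult_le_reg_r p); [lra|].
replace (2 * INR m * sh e * / p * p) with (INR m * (2 * sh e)) by (field; lra).
replace ((1 - (/ p) ^ 2) * p) with (p - / p) by (field; lra). exact H.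
Qed.

(** Writing p = r^m, slope = 2 m p + p^2 slope. Using the crude bound 1 / sinh t only in the second
    term keeps the summed estimates nearly sharp. *)
Lemma slope_bounds (m : nat) : (1 <= m)%nat ->
  0 <= slope r m <= / sh e /\ slope r m <= 2 * (INR m * r ^ m) + / sh e * (r ^ 2) ^ m.
Proof.
intros Hm. pose proof (one_sub_pow_sq_ge m) as H. unfold slope.
rewrite <- (pow_mult r 2 m), (Nat.mul_comm 2 m), pow_mult.
pose proof (pow_range r m radius_range Hm) as Hp. pose proof (pos_INR m) as Hn.
destruct (inv_sh_le e He) as [Hs _].
assert (Hsh : 0 < sh e) by (unfold sh; apply Rdiv_lt_0_compat; nra).
set (p := r ^ m) in *. set (s := sh e) in *.
assert (H1 : 0 < 1 - p ^ 2) by nra.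
assert (Hv : 2 * INR m * p / (1 - p ^ 2) <= / s).
{ apply (Rmult_le_reg_r (s * (1 - p ^ 2))); [now apply Rmult_lt_0_compat|]. field_simplify; nra. }
split; [split; [|exact Hv]|].
- apply Rdiv_le_0_compat; [|easy]. assert (0 <= INR m * p) by nra. lra.
- replace (2 * INR m * p / (1 - p ^ 2)) with (2 * (INR m * p) + 2 * INR m * p / (1 - p ^ 2) * p ^ 2)
    by (field; lra).
  apply Rplus_le_compat_l, Rmult_le_compat_r; [nra|exact Hv].
Qed.

Lemma radius_sq : r ^ 2 = / (1 + (2 * e + e ^ 2)).
Proof. unfold radius. rewrite pow_inv. f_equal. ring. Qed.

Lemma radius_cube : r ^ 3 = / (1 + (3 * e + 3 * e ^ 2 + e ^ 3)).
Proof. unfold radius. rewrite pow_inv. f_equal. ring. Qed.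

(** The leading term is (5/2) / e^2, where the infinite sum has (pi^2/4) / e^2. *)
Lemma sum_slope_le (K : nat) :
  sum1 (slope r) K <= 2 * ((1 + e) / e ^ 2) + (1 + e / 2) / e * / (2 * e + e ^ 2).
Proof.
apply Rle_trans with (sum1 (fun m => 2 * (INR m * r ^ m) + / sh e * (r ^ 2) ^ m) K).
{ apply sum1_le. intros m Hm. now apply slope_bounds. }
rewrite sum1_plus, !sum1_scal. destruct (inv_sh_le e He) as [H1 H2].
apply Rplus_le_compat.
- apply Rmult_le_compat_l; [lra|]. now apply geom_sum_1.
- rewrite radius_sq. apply Rle_trans with (/ sh e * / (2 * e + e ^ 2)).
  + apply Rmult_le_compat_l; [lra|]. apply geom_sum_0. nra.
  + apply Rmult_le_compat_r; [|easy]. left. apply Rinv_0_lt_compat. nra.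
Qed.

Lemma sum_sq_slope_le (K : nat) :
  sum1 (fun m => INR m ^ 2 * slope r m) K <=
  2 * ((1 + e) * (6 + 6 * e + e ^ 2) / e ^ 4) +
  (1 + e / 2) / e * ((1 + (2 * e + e ^ 2)) * (2 + (2 * e + e ^ 2)) / (2 * e + e ^ 2) ^ 3).
Proof.
apply Rle_trans with
  (sum1 (fun m => 2 * (INR m ^ 3 * r ^ m) + / sh e * (INR m ^ 2 * (r ^ 2) ^ m)) K).
{ apply sum1_le. intros m Hm.
  apply Rle_trans with (INR m ^ 2 * (2 * (INR m * r ^ m) + / sh e * (r ^ 2) ^ m)); [|right; ring].
  apply Rmult_le_compat_l; [apply pow2_ge_0|]. now apply slope_bounds. }
rewrite sum1_plus, !sum1_scal. destruct (inv_sh_le e He) as [H1 H2].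
apply Rplus_le_compat.
- apply Rmult_le_compat_l; [lra|]. now apply geom_sum_3.
- assert (He2 : 0 < 2 * e + e ^ 2) by nra. set (x := 2 * e + e ^ 2) in *.
  rewrite radius_sq. fold x. apply Rle_trans with (/ sh e * ((1 + x) * (2 + x) / x ^ 3)).
  + apply Rmult_le_compat_l; [lra|]. now apply geom_sum_2.
  + apply Rmult_le_compat_r; [|easy]. apply Rdiv_le_0_compat; [nra|now apply pow_lt].
Qed.

Lemma sum_cube_slope_le (K : nat) :
  sum1 (fun m => slope r m ^ 3) K <= ((1 + e / 2) / e) ^ 2 * sum1 (slope r) K.
Proof.
rewrite <- sum1_scal. apply sum1_le. intros m Hm.
destruct (slope_bounds m Hm) as [[H1 H2] _]. destruct (inv_sh_le e He) as [H3 H4].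
replace (slope r m ^ 3) with (slope r m ^ 2 * slope r m) by ring.
apply Rmult_le_compat_r; [easy|]. apply pow_incr. lra.
Qed.

(* Half the second derivative at 0 of - logmod (r ^ m) (cos (m th)). *)
Definition curvature (m : nat) : R :=
  INR m ^ 2 * (r ^ m * (1 + (r ^ m) ^ 2) / (1 - (r ^ m) ^ 2) ^ 2).

Lemma sum_curvature_le (K : nat) :
  sum1 curvature K <=
  (1 + e) * (2 + e) / e ^ 3
  + 3 / 2 * ((1 + e / 2) / e) * ((1 + (2 * e + e ^ 2)) / (2 * e + e ^ 2) ^ 2)
  + / 2 * ((1 + e / 2) / e) ^ 2 * / (3 * e).
Proof.
destruct (inv_sh_le e He) as [H1 H2]. set (w := (1 + e / 2) / e) in *.
apply Rle_trans with
  (sum1 (fun m => (INR m ^ 2 * r ^ m + 3 / 2 * w * (INR m * (r ^ 2) ^ m)) + / 2 * w ^ 2 * (r ^ 3) ^ m) K).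
{ apply sum1_le. intros m Hm. unfold curvature.
  rewrite <- (pow_mult r 2 m), <- (pow_mult r 3 m), (Nat.mul_comm 2 m), (Nat.mul_comm 3 m), !(pow_mult r m).
  destruct (slope_bounds m Hm) as [[G1 G2] G3]. unfold slope in *.
  pose proof (pow_range r m radius_range Hm) as Hp. pose proof (pos_INR m) as Hn.
  set (p := r ^ m) in *. set (n := INR m) in *.
  assert (Hd : 0 < 1 - p ^ 2) by nra.
  set (v := 2 * n * p / (1 - p ^ 2)) in *.
  assert (Hv : v * (1 - p ^ 2) = 2 * n * p) by (unfold v; field; lra).
  (* This factorisation is increasing in v, so v can be replaced by its bound w; expanding then
     gives geometric sums with ratios r, r^2 and r^3. *)
  replace (n ^ 2 * (p * (1 + p ^ 2) / (1 - p ^ 2) ^ 2)) with ((n * p + v * p ^ 2 / 2) * (n + v * p))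
    by (unfold v; field; lra).
  assert (Hvw : v <= w) by lra.
  apply Rle_trans with ((n * p + w * p ^ 2 / 2) * (n + w * p)); [|right; field].
  apply Rmult_le_compat; nra. }
rewrite !sum1_plus, !sum1_scal.
assert (Hw : 0 < w) by lra.
apply Rplus_le_compat; [apply Rplus_le_compat|].
- now apply geom_sum_2.
- apply Rmult_le_compat_l; [lra|]. rewrite radius_sq. apply geom_sum_1. nra.
- apply Rmult_le_compat_l; [nra|]. rewrite radius_cube.
  apply Rle_trans with (/ (3 * e + 3 * e ^ 2 + e ^ 3)).
  + apply geom_sum_0. assert (0 < e ^ 2) by nra. assert (0 < e ^ 3) by now apply pow_lt. lra.
  + assert (0 < e ^ 2) by nra. assert (0 < e ^ 3) by now apply pow_lt.
    apply Rinv_le_contravar; lra.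
Qed.

End Slope.

(** * Phase and modulus near the saddle point *)

Lemma nonneg_of_derive (f df : R -> R) (x : R) :
  (forall t, 0 <= t <= x -> is_derive f t (df t)) -> (forall t, 0 <= t <= x -> 0 <= df t) ->
  f 0 = 0 -> 0 <= x -> 0 <= f x.
Proof.
intros H1 H2 H0 Hx.
destruct (MVT_gen f 0 x df) as [t [Ht E]].
- intros t. rewrite Rmin_left, Rmax_right by lra. intros Ht. apply H1. lra.
- intros t. rewrite Rmin_left, Rmax_right by lra. intros Ht.
  apply continuity_pt_filterlim, (@ex_derive_continuous R_AbsRing R_NormedModule).
  exists (df t). now apply H1.
- rewrite Rmin_left, Rmax_right in Ht by lra. rewrite H0 in E.
  pose proof (H2 t Ht). nra.
Qed.

Lemma cos_ge_2 (x : R) : 1 - x ^ 2 / 2 <= cos x.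
Proof.
assert (H : forall y, 0 <= y -> 1 - y ^ 2 / 2 <= cos y).
{ intros y Hy. set (f := fun t => cos t - (1 - t ^ 2 / 2)).
  enough (0 <= f y) by (unfold f in *; lra).
  apply (nonneg_of_derive f (fun t => t - sin t)); unfold f; try easy.
  - intros t _. auto_derive; [easy|]. field.
  - intros t [[Ht|<-] _]; [pose proof (sin_lt_x t Ht); lra|rewrite sin_0; lra].
  - rewrite cos_0. field. }
destruct (Rle_dec 0 x); [now apply H|].
rewrite <- cos_neg. replace (x ^ 2) with ((- x) ^ 2) by ring. apply H. lra.
Qed.

Lemma sin_ge_3 (x : R) : 0 <= x -> x - x ^ 3 / 6 <= sin x.
Proof.
intros Hx. set (f := fun t => sin t - (t - t ^ 3 / 6)).
enough (0 <= f x) by (unfold f in *; lra).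
apply (nonneg_of_derive f (fun t => cos t - (1 - t ^ 2 / 2))); unfold f; try easy.
- intros t _. auto_derive; [easy|]. field.
- intros t _. pose proof (cos_ge_2 t). lra.
- rewrite sin_0. field.
Qed.

Lemma cos_le_4 (x : R) : 0 <= x -> cos x <= 1 - x ^ 2 / 2 + x ^ 4 / 24.
Proof.
intros Hx. set (f := fun t => 1 - t ^ 2 / 2 + t ^ 4 / 24 - cos t).
enough (0 <= f x) by (unfold f in *; lra).
apply (nonneg_of_derive f (fun t => sin t - (t - t ^ 3 / 6))); unfold f; try easy.
- intros t _. auto_derive; [easy|]. field.
- intros t [Ht _]. pose proof (sin_ge_3 t Ht). lra.
- rewrite cos_0. field.
Qed.

Lemma atan_le (x : R) : 0 <= x -> atan x <= x.
Proof.
intros Hx. set (f := fun t => t - atan t).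
enough (0 <= f x) by (unfold f in *; lra).
apply (nonneg_of_derive f (fun t => t ^ 2 / (1 + t ^ 2))); unfold f; try easy.
- intros t _. auto_derive; [easy|]. field. nra.
- intros t _. apply Rdiv_le_0_compat; nra.
- rewrite atan_0. ring.
Qed.

Lemma atan_ge_3 (x : R) : 0 <= x -> x - x ^ 3 / 3 <= atan x.
Proof.
intros Hx. set (f := fun t => atan t - (t - t ^ 3 / 3)).
enough (0 <= f x) by (unfold f in *; lra).
apply (nonneg_of_derive f (fun t => t ^ 4 / (1 + t ^ 2))); unfold f; try easy.
- intros t _. auto_derive; [easy|]. field. nra.
- intros t _. apply Rdiv_le_0_compat; [|nra]. replace (t ^ 4) with ((t ^ 2) ^ 2) by ring. apply pow2_ge_0.
- rewrite atan_0. field.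
Qed.

Lemma sin_le_id (x : R) : 0 <= x -> sin x <= x.
Proof. intros [H|<-]; [left; now apply sin_lt_x|rewrite sin_0; lra]. Qed.

Lemma phase_le (r : R) (m : nat) (th : R) : 0 < r < 1 -> (1 <= m)%nat -> 0 <= th ->
  phase (r ^ m) (sin (INR m * th)) <= slope r m * th.
Proof.
intros Hr Hm Ht. unfold phase, slope.
pose proof (pow_range r m Hr Hm) as Hp. pose proof (pos_INR m) as Hn. set (p := r ^ m) in *.
assert (Hx : 0 <= INR m * th) by now apply Rmult_le_pos.
pose proof (sin_le_id _ Hx) as Hsin. set (x := INR m * th) in *.
assert (Hd : 0 < 1 - p ^ 2) by nra.
assert (Hk : 0 < 2 * p / (1 - p ^ 2)) by (apply Rdiv_lt_0_compat; lra).
replace (2 * INR m * p / (1 - p ^ 2) * th) with (2 * p / (1 - p ^ 2) * x) by (unfold x; field; lra).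
replace (2 * p * sin x / (1 - p ^ 2)) with (2 * p / (1 - p ^ 2) * sin x) by (field; lra).
set (k := 2 * p / (1 - p ^ 2)) in *.
destruct (Rle_dec 0 (sin x)) as [H|H].
- apply Rle_trans with (k * sin x); [apply atan_le; nra|nra].
- apply Rle_trans with 0; [|nra]. rewrite <- atan_0. left. apply atan_increasing. nra.
Qed.

Lemma phase_ge (r : R) (m : nat) (th : R) : 0 < r < 1 -> (1 <= m)%nat -> 0 <= th ->
  slope r m * th - th ^ 3 * (INR m ^ 2 * slope r m / 6 + slope r m ^ 3 / 3) <=
  phase (r ^ m) (sin (INR m * th)).
Proof.
intros Hr Hm Ht. unfold phase, slope.
pose proof (pow_range r m Hr Hm) as Hp. pose proof (pos_INR m) as Hn. set (p := r ^ m) in *.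
assert (Hx : 0 <= INR m * th) by now apply Rmult_le_pos.
pose proof (sin_le_id _ Hx) as Hsin. pose proof (sin_ge_3 _ Hx) as Hsin'.
assert (Hd : 0 < 1 - p ^ 2) by nra.
assert (Hk : 0 < 2 * p / (1 - p ^ 2)) by (apply Rdiv_lt_0_compat; lra).
replace (2 * INR m * p / (1 - p ^ 2)) with (2 * p / (1 - p ^ 2) * INR m) by (field; lra).
replace (2 * p * sin (INR m * th) / (1 - p ^ 2)) with (2 * p / (1 - p ^ 2) * sin (INR m * th))
  by (field; lra).
set (k := 2 * p / (1 - p ^ 2)) in *.
replace (k * INR m * th - th ^ 3 * (INR m ^ 2 * (k * INR m) / 6 + (k * INR m) ^ 3 / 3))
  with (k * (INR m * th - (INR m * th) ^ 3 / 6) - (k * (INR m * th)) ^ 3 / 3) by field.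
set (x := INR m * th) in *. set (s := sin x) in *.
assert (Hkx : 0 <= k * x) by nra.
assert (H1 : k * (x - x ^ 3 / 6) <= k * s) by (apply Rmult_le_compat_l; lra).
destruct (Rle_dec 0 s) as [H|H].
- pose proof (atan_ge_3 (k * s) ltac:(nra)).
  assert ((k * s) ^ 3 <= (k * x) ^ 3) by (apply pow_incr; nra). lra.
- pose proof (atan_le (- (k * s)) ltac:(nra)) as H2. rewrite atan_opp in H2.
  assert (0 <= (k * x) ^ 3) by now apply pow_le. lra.
Qed.

Section Estimates.

Variables (e : R) (K N : nat).
Hypothesis He : 0 < e <= / 34.
Local Notation r := (radius e).
(** [saddle_phase] has derivative 0 at 0: [slope r m] is the derivative of the m-th phase, and 1 / e
    = r / (1 - r) that of the [atan] term. *)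
Hypothesis saddle : sum1 (slope r) K - / e = INR N.

Lemma sum_slope_num_le : sum1 (slope r) K <= 2.566 / e ^ 2.
Proof.
eapply Rle_trans; [apply sum_slope_le; lra|].
assert (He2 : 0 < e ^ 2) by nra.
replace (2 * ((1 + e) / e ^ 2) + (1 + e / 2) / e * / (2 * e + e ^ 2))
  with ((2 * (1 + e) + / 2) / e ^ 2) by (field; nra).
apply Rmult_le_compat_r; [left; now apply Rinv_0_lt_compat|lra].
Qed.

(** The constants combine as (12.72 + 0.278) / 6 + 2.643 / 3 < 3.05. *)
Lemma cubic_coef_le :
  sum1 (fun m => INR m ^ 2 * slope r m / 6 + slope r m ^ 3 / 3) K <= 3.05 / e ^ 4.
Proof.
rewrite (sum1_ext _ (fun m => / 6 * (INR m ^ 2 * slope r m) + / 3 * slope r m ^ 3))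
  by (intros; field).
rewrite sum1_plus, !sum1_scal.
pose proof (sum_sq_slope_le e ltac:(lra) K) as H1.
pose proof (sum_cube_slope_le e ltac:(lra) K) as H2.
pose proof sum_slope_num_le as H3.
assert (He4 : 0 < e ^ 4) by (apply pow_lt; lra).
assert (H4 : 2 * ((1 + e) * (6 + 6 * e + e ^ 2) / e ^ 4) <= 12.72 / e ^ 4).
{ unfold Rdiv. rewrite <- Rmult_assoc.
  apply Rmult_le_compat_r; [left; now apply Rinv_0_lt_compat|nra]. }
assert (H5 : (1 + e / 2) / e * ((1 + (2 * e + e ^ 2)) * (2 + (2 * e + e ^ 2)) / (2 * e + e ^ 2) ^ 3)
   <= 0.278 / e ^ 4).
{ replace ((1 + e / 2) / e * ((1 + (2 * e + e ^ 2)) * (2 + (2 * e + e ^ 2)) / (2 * e + e ^ 2) ^ 3))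
   with ((1 + e / 2) * (1 + (2 * e + e ^ 2)) * (2 + (2 * e + e ^ 2)) / (2 + e) ^ 3 / e ^ 4)
   by (field; split; nra).
  apply Rmult_le_compat_r; [left; now apply Rinv_0_lt_compat|].
  assert (8 <= (2 + e) ^ 3) by nra.
  apply (Rmult_le_reg_r ((2 + e) ^ 3)); [lra|].
  unfold Rdiv at 1. rewrite Rmult_assoc, Rinv_l, Rmult_1_r by lra.
  assert (2 * e + e ^ 2 <= 0.0597) by nra.
  apply Rle_trans with (1.0148 * 1.0597 * 2.0597); [|lra].
  apply Rmult_le_compat; try nra. }
assert (H6 : ((1 + e / 2) / e) ^ 2 * sum1 (slope r) K <= 2.643 / e ^ 4).
{ apply Rle_trans with (((1 + e / 2) / e) ^ 2 * (2.566 / e ^ 2)).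
  - apply Rmult_le_compat_l; [apply pow2_ge_0|easy].
  - replace (((1 + e / 2) / e) ^ 2 * (2.566 / e ^ 2)) with (2.566 * (1 + e / 2) ^ 2 / e ^ 4) by (field; lra).
    apply Rmult_le_compat_r; [left; now apply Rinv_0_lt_compat|nra]. }
assert (D : forall x, x / e ^ 4 = x * / e ^ 4) by easy. rewrite !D in *.
assert (0 < / e ^ 4) by now apply Rinv_0_lt_compat. lra.
Qed.

(** The true size is about th^3 / (3 e^3); it is weakened to the bound of [cubic_coef_le], which
    costs nothing in [saddle_phase_abs]. *)
Lemma one_sub_phase_bounds (th : R) : 0 <= th <= PI ->
  0 <= th / e - atan (r * sin th / (1 - r * cos th)) <= 3.05 / e ^ 4 * th ^ 3.
Proof.
intros Ht. pose proof (COS_bound th) as Hc. pose proof (cos_ge_2 th) as Hc2.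
pose proof (sin_ge_3 th ltac:(lra)) as Hs3. pose proof (sin_le_id th ltac:(lra)) as Hs1.
assert (Hs0 : 0 <= sin th) by (apply sin_ge_0; lra).
replace (r * sin th / (1 - r * cos th)) with (sin th / (e + (1 - cos th)))
  by (unfold radius; field; split; lra).
assert (Hx0 : 0 <= sin th / (e + (1 - cos th))) by (apply Rdiv_le_0_compat; lra).
assert (Hx1 : sin th / (e + (1 - cos th)) <= th / e).
{ apply (Rmult_le_reg_r (e * (e + (1 - cos th)))); [apply Rmult_lt_0_compat; lra|].
  field_simplify; try lra. nra. }
pose proof (atan_le _ Hx0) as A1. pose proof (atan_ge_3 _ Hx0) as A2.
split; [lra|].
assert (Ht3 : 0 <= th ^ 3) by (apply pow_le; lra).
assert (He2 : 0 < e ^ 2) by nra.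
assert (Hx2 : th / e - th ^ 3 * (/ (6 * e) + / (2 * e ^ 2)) <= sin th / (e + (1 - cos th))).
{ apply (Rmult_le_reg_r (e + (1 - cos th))); [lra|].
  replace (sin th / (e + (1 - cos th)) * (e + (1 - cos th))) with (sin th) by (field; lra).
  set (g := 1 - cos th) in *. assert (Hg : 0 <= g <= th ^ 2 / 2) by (unfold g; lra).
  assert (0 < / (6 * e) + / (2 * e ^ 2)).
  { apply Rplus_lt_0_compat; apply Rinv_0_lt_compat; nra. }
  apply Rle_trans with (th / e * (e + g) - th ^ 3 * (/ (6 * e) + / (2 * e ^ 2)) * e).
  { assert (0 <= th ^ 3 * (/ (6 * e) + / (2 * e ^ 2)) * g).
    { apply Rmult_le_pos; [apply Rmult_le_pos|]; lra. } lra. }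
  replace (th / e * (e + g) - th ^ 3 * (/ (6 * e) + / (2 * e ^ 2)) * e)
    with (th - th ^ 3 / 6 + th / e * (g - th ^ 2 / 2)) by (field; lra).
  assert (0 <= th / e) by (apply Rdiv_le_0_compat; lra). nra. }
assert (Hx3 : (sin th / (e + (1 - cos th))) ^ 3 <= (th / e) ^ 3) by (apply pow_incr; lra).
apply Rle_trans with (th ^ 3 * (/ (6 * e) + / (2 * e ^ 2)) + (th / e) ^ 3 / 3); [lra|].
replace (th ^ 3 * (/ (6 * e) + / (2 * e ^ 2)) + (th / e) ^ 3 / 3)
  with ((e ^ 3 / 6 + e ^ 2 / 2 + e / 3) / e ^ 4 * th ^ 3) by (field; lra).
apply Rmult_le_compat_r; [easy|].
apply Rmult_le_compat_r; [left; apply Rinv_0_lt_compat, pow_lt; lra|]. nra.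
Qed.

(** By the saddle equation the phase is a sum of two cubic errors: [total_phase] minus its tangent
    is nonpositive, and th / e minus the [atan] term is nonnegative. With opposite signs, the common
    bound is not doubled. *)
Lemma saddle_phase_abs (th : R) : 0 <= th <= PI ->
  Rabs (saddle_phase r K N th) <= 3.05 / e ^ 4 * th ^ 3.
Proof.
intros Ht. pose proof (radius_range e ltac:(lra)) as Hr.
pose proof (one_sub_phase_bounds th Ht) as H1. pose proof cubic_coef_le as H2.
assert (Ht3 : 0 <= th ^ 3) by (apply pow_le; lra).
assert (H3 : total_phase r K th <= sum1 (slope r) K * th).
{ rewrite Rmult_comm, <- sum1_scal. apply sum1_le. intros m Hm.
  rewrite (Rmult_comm th). apply phase_le; lra || easy. }
assert (H4 : sum1 (slope r) K * th -
    th ^ 3 * sum1 (fun m => INR m ^ 2 * slope r m / 6 + slope r m ^ 3 / 3) K <= total_phase r K th).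
{ unfold Rminus. rewrite (Rmult_comm _ th), Ropp_mult_distr_l, <- !sum1_scal, <- sum1_plus.
  apply sum1_le. intros m Hm.
  pose proof (phase_ge r m th Hr Hm ltac:(lra)). lra. }
apply (Rmult_le_compat_r (th ^ 3)) in H2; [|easy].
replace (sum1 (slope r) K) with (INR N + / e) in * by lra.
unfold saddle_phase. apply Rabs_le_between. unfold Rdiv in H1 at 1. lra.
Qed.

Lemma total_logmod_ge (th : R) :
  total_logmod r K 0 - 267 / 100 / e ^ 3 * th ^ 2 <= total_logmod r K th.
Proof.
pose proof (radius_range e ltac:(lra)) as Hr.
assert (H : sum1 (curvature e) K <= 267 / 100 / e ^ 3).
{ eapply Rle_trans; [apply sum_curvature_le; lra|].
  assert (He3 : 0 < e ^ 3) by (apply pow_lt; lra).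
  assert (B1 : (1 + e) * (2 + e) / e ^ 3 <= 2.0893 / e ^ 3).
  { apply Rmult_le_compat_r; [left; now apply Rinv_0_lt_compat|nra]. }
  assert (B2 : 3 / 2 * ((1 + e / 2) / e) * ((1 + (2 * e + e ^ 2)) / (2 * e + e ^ 2) ^ 2) <= 0.4035 / e ^ 3).
  { replace (3 / 2 * ((1 + e / 2) / e) * ((1 + (2 * e + e ^ 2)) / (2 * e + e ^ 2) ^ 2))
      with (3 / 2 * (1 + e / 2) * (1 + (2 * e + e ^ 2)) / (2 + e) ^ 2 / e ^ 3) by (field; nra).
    apply Rmult_le_compat_r; [left; now apply Rinv_0_lt_compat|].
    apply (Rmult_le_reg_r ((2 + e) ^ 2)); [nra|]. field_simplify; nra. }
  assert (B3 : / 2 * ((1 + e / 2) / e) ^ 2 * / (3 * e) <= 0.1717 / e ^ 3).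
  { replace (/ 2 * ((1 + e / 2) / e) ^ 2 * / (3 * e)) with (/ 6 * (1 + e / 2) ^ 2 / e ^ 3) by (field; lra).
    apply Rmult_le_compat_r; [left; now apply Rinv_0_lt_compat|nra]. }
  assert (D : forall x, x / e ^ 3 = x * / e ^ 3) by easy. rewrite !D in *.
  assert (0 < / e ^ 3) by now apply Rinv_0_lt_compat. lra. }
apply Rle_trans with (total_logmod r K 0 + - th ^ 2 * sum1 (curvature e) K).
{ assert (0 <= th ^ 2) by apply pow2_ge_0. nra. }
unfold total_logmod. rewrite <- sum1_scal, <- sum1_plus. apply sum1_le. intros m Hm.
pose proof (pow_range r m Hr Hm) as Hp.
rewrite Rmult_0_r, cos_0.
pose proof (COS_bound (INR m * th)) as Hc. pose proof (cos_ge_2 (INR m * th)) as Hc2.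
pose proof (logmod_lower (r ^ m) (cos (INR m * th)) ltac:(lra) Hc) as HL.
eapply Rle_trans; [|exact HL]. unfold curvature. set (p := r ^ m) in *.
assert (Hk : 0 <= p * (1 + p ^ 2) / (1 - p ^ 2) ^ 2).
{ apply Rdiv_le_0_compat; [nra|apply pow_lt; nra]. }
replace (2 * p * (1 + p ^ 2) / (1 - p ^ 2) ^ 2) with (2 * (p * (1 + p ^ 2) / (1 - p ^ 2) ^ 2))
  by (field; nra).
set (k := p * (1 + p ^ 2) / (1 - p ^ 2) ^ 2) in *. nra.
Qed.

End Estimates.

(** * Decay away from the saddle point *)

Lemma exp_ge_quadratic (x : R) : 0 <= x -> 1 + x + x ^ 2 / 2 <= exp x.
Proof.
intros Hx. set (f := fun t => exp t - (1 + t + t ^ 2 / 2)).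
enough (0 <= f x) by (unfold f in *; lra).
apply (nonneg_of_derive f (fun t => exp t - (1 + t))); unfold f; try easy.
- intros t _. auto_derive; [easy|]. field.
- intros t _. pose proof (exp_ineq1_le t). lra.
- rewrite exp_0. field.
Qed.

Lemma exp_le_compat (x y : R) : x <= y -> exp x <= exp y.
Proof. intros [H | ->]; [left; now apply exp_increasing | lra]. Qed.

Lemma exp_mult_INR (n : nat) (x : R) : exp (INR n * x) = exp x ^ n.
Proof.
induction n; [simpl; now rewrite Rmult_0_l, exp_0|].
rewrite S_INR, Rmult_plus_distr_r, Rmult_1_l, exp_plus, IHn. simpl. ring.
Qed.

(** For c >= k, exp (c z) / z^k increases on z >= 1. With z = 1 / (34 e), a numerical bound at e =
    1/34 thus extends to all smaller e. *)
Lemma exp_ge_scaled_pow (k : nat) (c z : R) : 0 < c -> INR k <= c -> 1 <= z ->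
  exp c * z ^ k <= exp (c * z).
Proof.
intros Hc Hk Hz.
replace (c * z) with (c + ((c - INR k) * (z - 1) + INR k * (z - 1))) by ring.
rewrite !exp_plus, exp_mult_INR. pose proof (exp_pos c).
apply Rmult_le_compat_l; [lra|].
apply Rle_trans with (1 * exp (z - 1) ^ k).
- rewrite Rmult_1_l. apply pow_incr. pose proof (exp_ineq1_le (z - 1)). lra.
- apply Rmult_le_compat_r; [apply pow_le; left; apply exp_pos|].
  pose proof (exp_ineq1_le ((c - INR k) * (z - 1))).
  assert (0 <= (c - INR k) * (z - 1)) by (apply Rmult_le_pos; lra). lra.
Qed.

Lemma exp_1_ge : 2.5 <= exp 1.
Proof. pose proof (exp_ge_quadratic 1 ltac:(lra)). lra. Qed.

(** Twice the real part of q + ... + q^K, cleared of its denominator |1 - q|^2; the terms with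
    r^(K+1) and r^(K+2) are the truncation error. *)
Lemma pow_sum_cos (r th : R) (K : nat) :
  2 * sum1 (fun m => r ^ m * cos (INR m * th)) K * chord_sq r th =
  2 * r * cos th - 2 * r ^ 2 - 2 * r ^ S K * cos (INR (S K) * th) + 2 * r ^ S (S K) * cos (INR K * th).
Proof.
induction K as [|K IH].
- simpl. rewrite Rmult_0_l, cos_0, Rmult_1_l. ring.
- cbn [sum1]. rewrite Rmult_plus_distr_l, Rmult_plus_distr_r, IH.
  rewrite (S_INR (S K)).
  replace (INR (S K)) with (INR K + 1) by (now rewrite S_INR).
  replace ((INR K + 1 + 1) * th) with ((INR K + 1) * th + th) by ring.
  replace (INR K * th) with ((INR K + 1) * th - th) by ring.
  rewrite cos_plus, cos_minus. unfold chord_sq. simpl. ring.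
Qed.

Section Upper.

Variables (e : R) (K N : nat).
Hypothesis He : 0 < e <= / 34.
Local Notation r := (radius e).
Hypothesis saddle : sum1 (slope r) K - / e = INR N.
(** Bounds the truncation error of the geometric sums in [sum_cos_gap]: 2 r^K / (1 - r)^2 at angle 0
    plus 4 r^K / (1 - r)^2 at th. *)
Hypothesis tail : 6 * r ^ K / (1 - r) ^ 2 <= / 100.

(** The relative excess of |1 - q|^2 over its value (1 - r)^2 at th = 0. *)
Definition gap (th : R) : R := 2 * (1 + e) * (1 - cos th) / e ^ 2.

Lemma gap_nonneg (th : R) : 0 <= gap th.
Proof.
unfold gap. pose proof (COS_bound th). apply Rdiv_le_0_compat; [nra|apply pow_lt; lra].
Qed.

Lemma chord_sq_gap (th : R) : chord_sq r th = (1 - r) ^ 2 * (1 + gap th).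
Proof. unfold chord_sq, gap, radius. field. lra. Qed.

(** For the infinite series the right-hand side equals (2 / e + 1) gap / (1 + gap). By
    [logmod_upper] it bounds the loss of log-modulus from below. *)
Lemma sum_cos_gap (th : R) :
  2 / e * (gap th / (1 + gap th)) - / 100 <=
  2 * sum1 (fun m => r ^ m * (1 - cos (INR m * th))) K.
Proof.
pose proof (radius_range e ltac:(lra)) as Hr. pose proof (gap_nonneg th) as Hw.
pose proof (chord_sq_gap th) as HD. pose proof (COS_bound th) as Hc.
assert (E : forall t, 2 * sum1 (fun m => r ^ m * cos (INR m * t)) K =
  (2 * r * cos t - 2 * r ^ 2 - 2 * r ^ S K * cos (INR (S K) * t) + 2 * r ^ S (S K) * cos (INR K * t))
  / chord_sq r t).
{ intros t. rewrite <- pow_sum_cos. field. rewrite chord_sq_gap.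
  pose proof (gap_nonneg t). apply Rgt_not_eq, Rmult_lt_0_compat; [apply pow_lt|]; lra. }
rewrite (sum1_ext _ (fun m => r ^ m * cos (INR m * 0) + -1 * (r ^ m * cos (INR m * th))))
  by (intros; rewrite Rmult_0_r, cos_0; ring).
rewrite sum1_plus, sum1_scal.
rewrite Rmult_plus_distr_l.
replace (2 * (-1 * sum1 (fun m => r ^ m * cos (INR m * th)) K))
  with (- (2 * sum1 (fun m => r ^ m * cos (INR m * th)) K)) by ring.
rewrite !E, !Rmult_0_r, cos_0.
replace (chord_sq r 0) with ((1 - r) ^ 2) by (unfold chord_sq; rewrite cos_0; ring).
set (q := r ^ K) in *. replace (r ^ S K) with (r * q) by reflexivity.
replace (r ^ S (S K)) with (r * (r * q)) by reflexivity.
assert (Hq : 0 < q) by (apply pow_lt; lra).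
pose proof (COS_bound (INR (S K) * th)) as H1. pose proof (COS_bound (INR K * th)) as H2.
set (c1 := cos (INR (S K) * th)) in *. set (c2 := cos (INR K * th)) in *.
set (D := chord_sq r th) in *.
assert (Hd : 0 < (1 - r) ^ 2) by (apply pow_lt; lra).
assert (HDd : (1 - r) ^ 2 <= D) by (rewrite HD; nra).
assert (B1 : -2 * q / (1 - r) ^ 2 <=
   (2 * r * 1 - 2 * r ^ 2 - 2 * (r * q) * 1 + 2 * (r * (r * q)) * 1) / (1 - r) ^ 2 - 2 * r / (1 - r)).
{ replace ((2 * r * 1 - 2 * r ^ 2 - 2 * (r * q) * 1 + 2 * (r * (r * q)) * 1) / (1 - r) ^ 2 - 2 * r / (1 - r))
   with (- 2 * (r * q * (1 - r)) / (1 - r) ^ 2) by (field; lra).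
  apply Rmult_le_compat_r; [left; now apply Rinv_0_lt_compat|].
  assert (r * q * (1 - r) <= q); [|lra].
  assert (r * (1 - r) <= 1) by nra. nra. }
assert (B2 : (2 * r * cos th - 2 * r ^ 2 - 2 * (r * q) * c1 + 2 * (r * (r * q)) * c2) / D
   <= (2 * r * cos th - 2 * r ^ 2) / D + 4 * q / (1 - r) ^ 2).
{ apply Rle_trans with ((2 * r * cos th - 2 * r ^ 2) / D + 4 * q / D).
  - unfold Rdiv. rewrite <- Rmult_plus_distr_r.
    apply Rmult_le_compat_r; [left; apply Rinv_0_lt_compat; lra|].
    assert (Hrq : 0 < r * q <= q) by (split; nra).
    assert (Hrrq : 0 < r * (r * q) <= q) by (split; nra).
    assert (- (r * q) * c1 <= q) by nra. assert (r * (r * q) * c2 <= q) by nra. lra.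
  - apply Rplus_le_compat_l. apply Rmult_le_compat_l; [lra|]. now apply Rinv_le_contravar. }
assert (B3 : 2 / e * (gap th / (1 + gap th)) <= 2 * r / (1 - r) - (2 * r * cos th - 2 * r ^ 2) / D).
{ rewrite HD. set (w := gap th) in *.
  assert (Ec : cos th = 1 - w * e ^ 2 / (2 * (1 + e))) by (unfold w, gap; field; lra).
  rewrite Ec. unfold radius.
  replace (2 * / (1 + e) / (1 - / (1 + e)) -
    (2 * / (1 + e) * (1 - w * e ^ 2 / (2 * (1 + e))) - 2 * (/ (1 + e)) ^ 2) /
    ((1 - / (1 + e)) ^ 2 * (1 + w))) with ((2 / e + 1) * (w / (1 + w))) by (field; lra).
  assert (0 <= w / (1 + w)) by (apply Rdiv_le_0_compat; lra). lra. }
replace (6 * q / (1 - r) ^ 2) with (4 * q / (1 - r) ^ 2 - (-2 * q / (1 - r) ^ 2)) in tail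
  by (field; lra).
lra.
Qed.

Definition rel_integrand (th : R) : R :=
  exp (total_logmod r K th - total_logmod r K 0) * sqrt (1 + gap th)
  * cos (saddle_phase r K N th) * (1 - cos th).

Lemma limit_integrand_rel (th : R) :
  limit_integrand r K N th = exp (total_logmod r K 0) * (1 - r) * rel_integrand th.
Proof.
pose proof (radius_range e ltac:(lra)) as Hr. pose proof (gap_nonneg th) as Hw.
unfold limit_integrand, rel_integrand.
rewrite chord_sq_gap, sqrt_mult by (try apply pow_le; lra).
rewrite sqrt_pow2 by lra.
replace (total_logmod r K th) with (total_logmod r K 0 + (total_logmod r K th - total_logmod r K 0)) at 1
  by ring.
rewrite exp_plus. ring.
Qed.

Lemma total_logmod_upper (th : R) :
  total_logmod r K th - total_logmod r K 0 <= - (2 / e * (gap th / (1 + gap th))) + / 100.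
Proof.
pose proof (radius_range e ltac:(lra)) as Hr. pose proof (sum_cos_gap th) as H.
assert (HL : total_logmod r K th <= total_logmod r K 0 +
   -2 * sum1 (fun m => r ^ m * (1 - cos (INR m * th))) K).
{ unfold total_logmod. rewrite <- sum1_scal, <- sum1_plus. apply sum1_le. intros m Hm.
  pose proof (pow_range r m Hr Hm) as Hp. rewrite Rmult_0_r, cos_0.
  pose proof (logmod_upper (r ^ m) (cos (INR m * th)) ltac:(lra) (COS_bound _)). lra. }
lra.
Qed.

(** The cosine of the phase is bounded by -1 only. The parameters t and s stand for range-specific
    bounds on the decay and on |1 - q| / (1 - r); 1.0102 exceeds exp (1/100) <= 1 / (1 - 1/100). *)
Lemma rel_integrand_tail (th t s : R) :
  t <= gap th / (1 + gap th) -> 1 + gap th <= s ^ 2 -> 0 <= s ->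
  - (1.0102 * s * (1 - cos th) * exp (- (2 / e * t))) <= rel_integrand th.
Proof.
intros Ht Hs Hs0. unfold rel_integrand.
pose proof (COS_bound th) as Hc. pose proof (COS_bound (saddle_phase r K N th)) as HP.
pose proof (gap_nonneg th) as Hw.
assert (H1 : exp (total_logmod r K th - total_logmod r K 0) <= 1.0102 * exp (- (2 / e * t))).
{ apply Rle_trans with (exp (/ 100) * exp (- (2 / e * t))).
  - rewrite <- exp_plus. apply exp_le_compat. pose proof (total_logmod_upper th).
    assert (0 < 2 / e) by (apply Rdiv_lt_0_compat; lra).
    assert (2 / e * t <= 2 / e * (gap th / (1 + gap th))) by (apply Rmult_le_compat_l; lra). lra.
  - apply Rmult_le_compat_r; [left; apply exp_pos|].
    pose proof (exp_ineq1_le (- / 100)) as H. rewrite exp_Ropp in H. pose proof (exp_pos (/ 100)).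
    apply (Rmult_le_compat_r (exp (/ 100))) in H; [|lra]. rewrite Rinv_l in H by lra. lra. }
assert (H2 : sqrt (1 + gap th) <= s).
{ rewrite <- (sqrt_pow2 s) by easy. now apply sqrt_le_1_alt. }
pose proof (exp_pos (total_logmod r K th - total_logmod r K 0)) as H3.
pose proof (sqrt_pos (1 + gap th)) as H4.
set (E := exp (_ - _)) in *. set (F := exp (- _)) in *. set (S := sqrt _) in *.
set (c := cos (saddle_phase _ _ _ _)) in *. set (d := 1 - cos th) in *.
assert (Hd : 0 <= d) by (unfold d; lra).
assert (H5 : E * S <= 1.0102 * F * s) by (apply Rmult_le_compat; lra).
assert (H6 : 0 <= E * S) by (apply Rmult_le_pos; lra).
assert (H7 : E * S * d <= 1.0102 * F * s * d) by (apply Rmult_le_compat_r; lra).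
assert (H8 : 0 <= E * S * d * (1 + c)) by (apply Rmult_le_pos; [apply Rmult_le_pos|]; lra).
lra.
Qed.

Lemma gap_ge (th : R) : 0 <= th <= e -> (th / e) ^ 2 <= gap th.
Proof.
intros Ht. pose proof (cos_le_4 th ltac:(lra)) as Hc. unfold gap.
replace ((th / e) ^ 2) with (th ^ 2 / e ^ 2) by (field; lra).
apply Rmult_le_compat_r; [left; apply Rinv_0_lt_compat, pow_lt; lra|].
apply Rle_trans with (2 * (1 + e) * (th ^ 2 / 2 - th ^ 4 / 24)).
- assert (0 <= th ^ 2 <= e ^ 2) by (split; nra).
  replace (2 * (1 + e) * (th ^ 2 / 2 - th ^ 4 / 24)) with (th ^ 2 * ((1 + e) * (1 - th ^ 2 / 12))) by field.
  rewrite <- (Rmult_1_r (th ^ 2)) at 1. apply Rmult_le_compat_l; nra.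
- apply Rmult_le_compat_l; lra.
Qed.

Lemma gap_le (th : R) : gap th <= 1.03 * (th / e) ^ 2.
Proof.
pose proof (cos_ge_2 th) as Hc. unfold gap.
replace (1.03 * (th / e) ^ 2) with (1.03 * th ^ 2 / e ^ 2) by (field; lra).
apply Rmult_le_compat_r; [left; apply Rinv_0_lt_compat, pow_lt; lra|].
apply Rle_trans with (2 * (1 + e) * (th ^ 2 / 2)); [apply Rmult_le_compat_l; lra|].
pose proof (pow2_ge_0 th). nra.
Qed.

Lemma frac_mono (u v : R) : 0 <= u <= v -> u / (1 + u) <= v / (1 + v).
Proof.
intros H. apply (Rmult_le_reg_r ((1 + u) * (1 + v))); [nra|]. field_simplify; lra.
Qed.

(** Here (th / e)^2 <= 1/4, whence 4/5 = 1 / (1 + 1/4) in the decay, 1.1214^2 >= 1 + 1.03 / 4, and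
    1.0102 * 1.1214 / 2 < 0.567. *)
Lemma rel_integrand_near (th : R) : 0 <= th <= e / 2 ->
  - (0.567 * th ^ 2 * exp (- (8 / 5 * th ^ 2 / e ^ 3))) <= rel_integrand th.
Proof.
intros Ht. pose proof (gap_ge th ltac:(lra)) as H1. pose proof (gap_le th) as H2.
pose proof (cos_ge_2 th) as Hc.
assert (Hx : 0 <= th / e <= / 2).
{ split; [apply Rdiv_le_0_compat; lra|]. apply (Rmult_le_reg_r e); [lra|]. field_simplify; lra. }
assert (H0 : 0 <= (th / e) ^ 2 <= / 4) by (split; nra).
eapply Rle_trans; [|apply (rel_integrand_tail th ((4 / 5) * (th / e) ^ 2) 1.1214)].
- replace (2 / e * ((4 / 5) * (th / e) ^ 2)) with (8 / 5 * th ^ 2 / e ^ 3) by (field; lra).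
  set (E := exp _). assert (0 < E) by apply exp_pos.
  assert (0 <= (th ^ 2 / 2 - (1 - cos th)) * E) by (apply Rmult_le_pos; lra).
  assert (0 <= th ^ 2 * E) by (apply Rmult_le_pos; [apply pow2_ge_0|lra]). lra.
- apply Rle_trans with ((th / e) ^ 2 / (1 + (th / e) ^ 2)).
  + set (u := (th / e) ^ 2) in *. apply (Rmult_le_reg_r (1 + u)); [lra|].
    replace (u / (1 + u) * (1 + u)) with u by (field; lra). nra.
  + apply frac_mono. lra.
- lra.
- lra.
Qed.

(** Now 1/4 <= (th / e)^2 <= 1, so gap / (1 + gap) >= 1/5 and 1.425^2 >= 1 + 1.03. *)
Lemma rel_integrand_mid (th : R) : e / 2 <= th <= e ->
  - (0.73 * th ^ 2 * exp (- (2 / 5 / e))) <= rel_integrand th.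
Proof.
intros Ht. pose proof (gap_ge th ltac:(lra)) as H1. pose proof (gap_le th) as H2.
pose proof (cos_ge_2 th) as Hc.
assert (Hx : / 2 <= th / e <= 1).
{ split; apply (Rmult_le_reg_r e); try lra; field_simplify; lra. }
assert (H0 : / 4 <= (th / e) ^ 2 <= 1) by (split; nra).
eapply Rle_trans; [|apply (rel_integrand_tail th (/ 5) 1.425)].
- replace (2 / e * / 5) with (2 / 5 / e) by (field; lra).
  set (E := exp _). assert (0 < E) by apply exp_pos.
  assert (0 <= (th ^ 2 / 2 - (1 - cos th)) * E) by (apply Rmult_le_pos; lra).
  assert (0 <= th ^ 2 * E) by (apply Rmult_le_pos; [apply pow2_ge_0|lra]). lra.
- apply Rle_trans with (/ 4 / (1 + / 4)); [lra|]. apply frac_mono. lra.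
- lra.
- lra.
Qed.

Lemma rel_integrand_far (th : R) : e <= th <= PI ->
  - (4.3 / e * exp (- (1 / e))) <= rel_integrand th.
Proof.
intros Ht. pose proof (COS_bound th) as Hc.
assert (H1 : 1 <= gap th).
{ apply Rle_trans with (gap e).
  - pose proof (gap_ge e ltac:(lra)) as H. replace (e / e) with 1 in H by (field; lra). lra.
  - unfold gap. apply Rmult_le_compat_r; [left; apply Rinv_0_lt_compat, pow_lt; lra|].
    apply Rmult_le_compat_l; [lra|].
    destruct (Req_dec e th) as [<-|Hne]; [lra|].
    pose proof (cos_decreasing_1 e th ltac:(lra) ltac:(lra) ltac:(lra) ltac:(lra) ltac:(lra)). lra. }
eapply Rle_trans; [|apply (rel_integrand_tail th (/ 2) (21 / 10 / e))].
- replace (2 / e * / 2) with (1 / e) by (field; lra).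
  set (E := exp _). assert (0 < E) by apply exp_pos.
  assert (0 < / e * E) by (apply Rmult_lt_0_compat; [apply Rinv_0_lt_compat|]; lra).
  assert (0 <= (1 + cos th) * (/ e * E)) by (apply Rmult_le_pos; lra).
  unfold Rdiv. lra.
- apply Rle_trans with (1 / (1 + 1)); [lra|]. apply frac_mono. lra.
- apply Rle_trans with (1 + 4.12 / e ^ 2).
  + apply Rplus_le_compat_l. unfold gap.
    apply Rmult_le_compat_r; [left; apply Rinv_0_lt_compat, pow_lt; lra|]. nra.
  + replace ((21 / 10 / e) ^ 2) with (441 / 100 / e ^ 2) by (field; lra).
    apply (Rmult_le_reg_r (e ^ 2)); [apply pow_lt; lra|]. field_simplify; nra.
- apply Rdiv_le_0_compat; lra.
Qed.

Lemma rel_integrand_nonneg (th : R) : 0 <= th <= PI -> 3.05 / e ^ 4 * th ^ 3 <= 1.5 ->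
  0 <= rel_integrand th.
Proof.
intros Ht Hs. pose proof (saddle_phase_abs e K N He saddle th Ht) as H.
apply Rabs_le_between in H. pose proof (COS_bound th). pose proof PI2_3_2.
unfold rel_integrand. repeat apply Rmult_le_pos; try lra.
- left; apply exp_pos.
- apply sqrt_pos.
- apply cos_ge_0; lra.
Qed.

(** Using (1 - x)^2 <= exp (- 2 x) makes the lower bound a polynomial, which is integrated exactly.
    0.944 comes from 1 - 0.333^2 / 2, and 0.944 * 0.4999 > 0.47. *)
Lemma rel_integrand_central (th : R) : 0 <= th <= 0.005 ->
  3.05 / e ^ 4 * th ^ 3 <= 0.333 -> 267 / 200 * th ^ 2 / e ^ 3 <= 1 ->
  0.47 * th ^ 2 * (1 - 267 / 200 * th ^ 2 / e ^ 3) ^ 2 <= rel_integrand th.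
Proof.
intros Ht Hs Hv. pose proof PI2_3_2.
pose proof (saddle_phase_abs e K N He saddle th ltac:(lra)) as H0.
pose proof (total_logmod_ge e K He th) as HL. pose proof (gap_nonneg th) as Hw.
pose proof (cos_le_4 th ltac:(lra)) as Hc.
set (x := 267 / 200 * th ^ 2 / e ^ 3) in *.
assert (H1 : (1 - x) ^ 2 <= exp (total_logmod r K th - total_logmod r K 0)).
{ apply Rle_trans with (exp (INR 2 * - x)).
  - rewrite exp_mult_INR. apply pow_incr. pose proof (exp_ineq1_le (- x)). lra.
  - apply exp_le_compat. replace (INR 2 * - x) with (- (267 / 100 / e ^ 3 * th ^ 2)); [lra|].
    unfold x. simpl INR. field. lra. }
assert (H2 : 1 <= sqrt (1 + gap th)).
{ rewrite <- sqrt_1 at 1. apply sqrt_le_1_alt. lra. }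
assert (H3 : 0.944 <= cos (saddle_phase r K N th)).
{ pose proof (cos_ge_2 (saddle_phase r K N th)) as H3. rewrite <- pow2_abs in H3.
  pose proof (Rabs_pos (saddle_phase r K N th)). nra. }
assert (H4 : 0.4999 * th ^ 2 <= 1 - cos th).
{ assert (th ^ 2 <= 0.000025) by nra. pose proof (pow2_ge_0 th).
  replace (th ^ 4) with (th ^ 2 * th ^ 2) in Hc by ring. nra. }
unfold rel_integrand. pose proof (pow2_ge_0 (1 - x)) as H5. pose proof (pow2_ge_0 th) as H6.
apply Rle_trans with ((1 - x) ^ 2 * 1 * 0.944 * (0.4999 * th ^ 2)).
- assert (0 <= (1 - x) ^ 2 * th ^ 2) by now apply Rmult_le_pos. lra.
- repeat apply Rmult_le_compat; try lra.
Qed.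

End Upper.

(** * Positivity of the integral *)

Lemma RInt_ge_antiderivative (f G dG : R -> R) (x y : R) : x <= y -> ex_RInt f x y ->
  (forall t, is_derive G t (dG t)) -> (forall t, continuous dG t) ->
  (forall t, x <= t <= y -> dG t <= f t) -> G y - G x <= RInt f x y.
Proof.
intros Hxy Hf HG Hc H.
assert (HI : is_RInt dG x y (minus (G y) (G x))).
{ apply (@is_RInt_derive R_CompleteNormedModule); intros; [apply HG|apply Hc]. }
change (G y - G x) with (minus (G y) (G x)).
rewrite <- (is_RInt_unique _ _ _ _ HI). apply RInt_le; try easy.
- eexists; exact HI.
- intros t Ht. apply H. lra.
Qed.

Section Positivity.

Variables (e : R) (K N : nat).
Hypothesis He : 0 < e <= / 34.
Local Notation r := (radius e).
Hypothesis saddle : sum1 (slope r) K - / e = INR N.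
Hypothesis tail : 6 * r ^ K / (1 - r) ^ 2 <= / 100.
Local Notation f := (rel_integrand e K N).

Lemma norm_pos : 0 < exp (total_logmod r K 0) * (1 - r).
Proof.
pose proof (radius_range e ltac:(lra)). apply Rmult_lt_0_compat; [apply exp_pos|lra].
Qed.

Lemma ex_RInt_rel (x y : R) : ex_RInt f x y.
Proof.
pose proof (radius_range e ltac:(lra)) as Hr. pose proof norm_pos as HM.
set (M := exp _ * _) in *.
apply (ex_RInt_ext (fun t => scal (/ M) (limit_integrand r K N t))).
- intros t _. rewrite limit_integrand_rel by easy. fold M.
  unfold scal; simpl; unfold mult; simpl. field. lra.
- apply (@ex_RInt_scal R_NormedModule). now apply ex_RInt_limit_integrand.
Qed.

Lemma exp_mid_small (h : R) : 0 < h -> e = h ^ 2 -> exp (- (2 / 5 / e)) <= 0.008 * h ^ 3.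
Proof.
intros Hh Eh. set (z := / (34 * e)).
assert (Hz : 1 <= z).
{ unfold z. rewrite <- Rinv_1. apply Rinv_le_contravar; lra. }
replace (2 / 5 / e) with (68 / 5 * z) by (unfold z; field; lra).
pose proof (exp_ge_scaled_pow 2 (68 / 5) z ltac:(lra) ltac:(simpl; lra) Hz) as H.
assert (H1 : 140000 <= exp (68 / 5)).
{ apply Rle_trans with (exp (INR 13 * 1)).
  - rewrite exp_mult_INR. apply Rle_trans with (2.5 ^ 13); [lra|].
    apply pow_incr. pose proof exp_1_ge. lra.
  - apply exp_le_compat. simpl; lra. }
assert (H2 : 140000 * z ^ 2 <= exp (68 / 5 * z)).
{ eapply Rle_trans; [|exact H]. apply Rmult_le_compat_r; [apply pow2_ge_0|easy]. }
rewrite exp_Ropp.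
apply (Rmult_le_reg_r (exp (68 / 5 * z))); [apply exp_pos|].
rewrite Rinv_l by apply Rgt_not_eq, exp_pos.
apply Rle_trans with (0.008 * h ^ 3 * (140000 * z ^ 2)).
- assert (Hhe : 5 * h ^ 4 <= h ^ 3).
  { assert (5 * h <= 1) by nra. assert (0 < h ^ 3) by now apply pow_lt.
    replace (h ^ 4) with (h * h ^ 3) by ring. nra. }
  apply Rle_trans with (0.008 * (5 * h ^ 4) * (140000 * z ^ 2)).
  + unfold z. rewrite Eh. replace (0.008 * (5 * h ^ 4) * (140000 * (/ (34 * h ^ 2)) ^ 2))
      with (0.008 * 5 * 140000 / 1156) by (field; lra). lra.
  + pose proof (pow2_ge_0 z). apply Rmult_le_compat_r; lra.
- apply Rmult_le_compat_l; [|easy]. assert (0 < h ^ 3) by now apply pow_lt. lra.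
Qed.

Lemma exp_far_small (h : R) : 0 < h -> e = h ^ 2 -> 20 / e * exp (- (1 / e)) <= 0.002 * h ^ 9.
Proof.
intros Hh Eh. set (z := / (34 * e)).
assert (Hz : 1 <= z).
{ unfold z. rewrite <- Rinv_1. apply Rinv_le_contravar; lra. }
replace (1 / e) with (34 * z) by (unfold z; field; lra).
pose proof (exp_ge_scaled_pow 6 34 z ltac:(lra) ltac:(simpl; lra) Hz) as H.
assert (H1 : 2.5 ^ 34 <= exp 34).
{ apply Rle_trans with (exp (INR 34 * 1)).
  - rewrite exp_mult_INR. apply pow_incr. pose proof exp_1_ge. lra.
  - apply exp_le_compat. simpl; lra. }
assert (H1' : 30000000000000 <= exp 34) by (eapply Rle_trans; [|exact H1]; lra).
assert (Hz6 : 0 < z ^ 6) by (apply pow_lt; lra).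
assert (H2 : 30000000000000 * z ^ 6 <= exp (34 * z)).
{ eapply Rle_trans; [|exact H]. apply Rmult_le_compat_r; lra. }
rewrite exp_Ropp.
apply (Rmult_le_reg_r (exp (34 * z))); [apply exp_pos|].
rewrite Rmult_assoc, Rinv_l, Rmult_1_r by apply Rgt_not_eq, exp_pos.
assert (Hhe : 5 * h ^ 10 <= h ^ 9).
{ assert (5 * h <= 1) by nra. assert (0 < h ^ 9) by now apply pow_lt.
  replace (h ^ 10) with (h * h ^ 9) by ring. nra. }
apply Rle_trans with (0.002 * (5 * h ^ 10) * (30000000000000 * z ^ 6)).
- unfold z. rewrite Eh. replace (0.002 * (5 * h ^ 10) * (30000000000000 * (/ (34 * h ^ 2)) ^ 6))
      with (0.002 * 5 * 30000000000000 / 34 ^ 6 * / h ^ 2) by (field; lra).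
  unfold Rdiv at 1. apply Rmult_le_compat_r; [left; apply Rinv_0_lt_compat, pow_lt; lra|]. lra.
- apply Rmult_le_compat; try lra. assert (0 < h ^ 10) by now apply pow_lt. lra.
Qed.

Lemma exp_gauss_small : exp (- (8 / 5 * 1.42 ^ 2)) <= 0.043.
Proof.
rewrite exp_Ropp. rewrite <- (Rinv_inv 0.043). apply Rinv_le_contravar; [lra|].
apply Rle_trans with (exp (INR 8 * 0.4032)).
- rewrite exp_mult_INR. apply Rle_trans with (1.484 ^ 8); [lra|].
  apply pow_incr. pose proof (exp_ge_quadratic 0.4032 ltac:(lra)). lra.
- apply exp_le_compat. simpl INR. lra.
Qed.

(** In units of h^9, the central range contributes at least 0.0231. The losses are below 0.0129 in
    the Gaussian range, and 0.002 each on [e/2, e] and [e, pi]. *)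
Lemma integral_pos : 0 < RInt (limit_integrand r K N) 0 PI.
Proof.
set (h := sqrt e). assert (Hh : 0 < h) by (apply sqrt_lt_R0; lra).
assert (Eh : e = h ^ 2) by (unfold h; now rewrite pow2_sqrt by lra).
assert (Hh2 : h <= 0.1715) by nra.
assert (Hh3 : 0 < h ^ 3) by now apply pow_lt.
assert (Hh9 : 0 < h ^ 9) by now apply pow_lt.
assert (Hh3' : h ^ 3 <= 0.00505).
{ apply Rle_trans with (0.1715 ^ 3); [apply pow_incr; lra|lra]. }
pose proof PI2_3_2 as Hpi.
(* With h <= 0.1715, the phase bound 3.05 y^3 h is at most 0.333 for y = 0.86, as
   [rel_integrand_central] requires, and at most 1.5 < pi / 2 for y = 1.42, where the cosine is
   still nonnegative. *)
set (a1 := 0.86 * h ^ 3). set (a2 := 1.42 * h ^ 3).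
assert (Ha2 : a2 <= e / 2).
{ unfold a2. rewrite Eh. replace (h ^ 3) with (h * h ^ 2) by ring.
  assert (0 < h ^ 2) by now apply pow_lt. nra. }
assert (Ha12 : 0 < a1 < a2) by (unfold a1, a2; lra).
(* In the rescaled variable t / h^3 the cubic phase bound carries one factor h. *)
assert (cub : forall y t, 0 <= t <= y * h ^ 3 -> 0 <= y -> 3.05 / e ^ 4 * t ^ 3 <= 3.05 * y ^ 3 * h).
{ intros y t Ht Hy. apply Rle_trans with (3.05 / e ^ 4 * (y * h ^ 3) ^ 3).
  - apply Rmult_le_compat_l; [|now apply pow_incr].
    apply Rdiv_le_0_compat; [lra|apply pow_lt; lra].
  - rewrite Eh. right. field. lra. }
assert (I1 : 0.0231 * h ^ 9 <= RInt f 0 a1).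
{ set (G := fun t => 0.47 * (t ^ 3 / 3 - 267 / 500 * t ^ 5 / e ^ 3 + (267 / 200) ^ 2 / 7 * t ^ 7 / e ^ 6)).
  apply Rle_trans with (G a1 - G 0).
  - unfold G, a1. rewrite Eh.
    replace (0.47 * ((0.86 * h ^ 3) ^ 3 / 3 - 267 / 500 * (0.86 * h ^ 3) ^ 5 / (h ^ 2) ^ 3 +
       (267 / 200) ^ 2 / 7 * (0.86 * h ^ 3) ^ 7 / (h ^ 2) ^ 6) -
      0.47 * (0 ^ 3 / 3 - 267 / 500 * 0 ^ 5 / (h ^ 2) ^ 3 + (267 / 200) ^ 2 / 7 * 0 ^ 7 / (h ^ 2) ^ 6))
    with (0.47 * (0.86 ^ 3 / 3 - 267 / 500 * 0.86 ^ 5 + (267 / 200) ^ 2 / 7 * 0.86 ^ 7) * h ^ 9)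
      by (field; lra).
    apply Rmult_le_compat_r; lra.
  - apply (RInt_ge_antiderivative _ _ (fun t => 0.47 * t ^ 2 * (1 - 267 / 200 * t ^ 2 / e ^ 3) ^ 2)).
    + lra.
    + apply ex_RInt_rel.
    + intros t. unfold G. auto_derive; [easy|]. field. lra.
    + intros t. apply (@ex_derive_continuous R_AbsRing R_NormedModule). now auto_derive.
    + intros t Ht. unfold a1 in *. apply rel_integrand_central; try easy.
      * lra.
      * eapply Rle_trans; [apply (cub 0.86); lra|]. lra.
      * apply (Rmult_le_reg_r (e ^ 3)); [apply pow_lt; lra|].
        unfold Rdiv at 1. rewrite Rmult_assoc, Rinv_l, Rmult_1_r, Rmult_1_l by (apply Rgt_not_eq, pow_lt; lra).
        rewrite Eh. replace ((h ^ 2) ^ 3) with (h ^ 3 * h ^ 3) by ring. nra. }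
assert (I2 : 0 <= RInt f a1 a2).
{ apply RInt_ge_0; [lra|apply ex_RInt_rel|]. intros t Ht.
  apply rel_integrand_nonneg; try easy; [lra|].
  eapply Rle_trans; [apply (cub 1.42); unfold a2 in *; lra|]. lra. }
assert (I3 : - (0.567 * 0.371 * 1.42 * 0.043 * h ^ 9) <= RInt f a2 (e / 2)).
(* The Gaussian moment has no elementary antiderivative, but beyond a2 a multiple of t exp (- c t^2)
   has a derivative below the bound. There e^3 <= t^2 / 1.42^2, and 0.371 slightly exceeds 1 / (16/5
   - 1 / 1.42^2). *)
{ pose (k := 0.567 * 0.371). set (c := 8 / 5 / e ^ 3).
  assert (Hc : 0 < c) by (apply Rdiv_lt_0_compat; [lra|apply pow_lt; lra]).
  set (G := fun t => k * e ^ 3 * (t * exp (- (c * t ^ 2)))).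
  apply Rle_trans with (G (e / 2) - G a2).
  - assert (He3 : 0 < k * e ^ 3) by (apply Rmult_lt_0_compat; [unfold k; lra|apply pow_lt; lra]).
    assert (0 <= G (e / 2)).
    { apply Rmult_le_pos; [lra|]. apply Rmult_le_pos; [lra|left; apply exp_pos]. }
    assert (G a2 <= 0.567 * 0.371 * 1.42 * 0.043 * h ^ 9); [|lra].
    apply Rle_trans with (k * e ^ 3 * (a2 * 0.043)).
    + apply Rmult_le_compat_l; [lra|]. apply Rmult_le_compat_l; [lra|].
      replace (c * a2 ^ 2) with (8 / 5 * 1.42 ^ 2); [exact exp_gauss_small|].
      unfold c, a2. rewrite Eh. field. lra.
    + unfold k, a2. rewrite Eh. right. ring.
  - apply (RInt_ge_antiderivative _ _ (fun t => k * e ^ 3 * ((1 - 2 * c * t ^ 2) * exp (- (c * t ^ 2))))).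
    + easy.
    + apply ex_RInt_rel.
    + intros t. unfold G. auto_derive; [easy|]. simpl. ring.
    + intros t. apply (@ex_derive_continuous R_AbsRing R_NormedModule). now auto_derive.
    + intros t Ht. eapply Rle_trans; [|apply rel_integrand_near; try easy; lra].
      replace (8 / 5 * t ^ 2 / e ^ 3) with (c * t ^ 2) by (unfold c; field; lra).
      pose proof (exp_pos (- (c * t ^ 2))) as HE. set (E := exp _) in *.
      enough (k * e ^ 3 * (1 - 2 * c * t ^ 2) <= - (0.567 * t ^ 2)) by nra.
      replace (k * e ^ 3 * (1 - 2 * c * t ^ 2)) with (k * (e ^ 3 - 16 / 5 * t ^ 2)) by (unfold c; field; lra).
      assert (e ^ 3 <= t ^ 2 / 1.42 ^ 2).
      { assert (a2 ^ 2 <= t ^ 2) by (apply pow_incr; lra).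
        apply (Rmult_le_reg_r (1.42 ^ 2)); [lra|]. unfold Rdiv. rewrite Rmult_assoc, Rinv_l, Rmult_1_r by lra.
        eapply Rle_trans; [|exact H]. unfold a2. rewrite Eh. right. ring. }
      pose proof (pow2_ge_0 t). unfold k. lra. }
assert (I4 : - (0.002 * h ^ 9) <= RInt f (e / 2) e).
{ set (E := exp (- (2 / 5 / e))).
  assert (HE : 0 < E <= 0.008 * h ^ 3) by (split; [apply exp_pos|now apply exp_mid_small]).
  set (G := fun t => - (0.73 * (t ^ 3 / 3) * E)).
  apply Rle_trans with (G e - G (e / 2)).
  - unfold G. assert (0 < e ^ 3) by (apply pow_lt; lra).
    apply Rle_trans with (- (0.73 / 3 * e ^ 3 * E)).
    + assert (e ^ 3 * E <= e ^ 3 * (0.008 * h ^ 3)) by (apply Rmult_le_compat_l; lra).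
      replace (h ^ 9) with (e ^ 3 * h ^ 3) by (rewrite Eh; ring).
      assert (0 < e ^ 3 * h ^ 3) by now apply Rmult_lt_0_compat. lra.
    + assert (0 <= (e / 2) ^ 3 * E) by (apply Rmult_le_pos; [apply pow_le; lra|lra]). lra.
  - apply (RInt_ge_antiderivative _ _ (fun t => - (0.73 * t ^ 2 * E))).
    + lra.
    + apply ex_RInt_rel.
    + intros t. unfold G. auto_derive; [easy|]. simpl. field.
    + intros t. apply (@ex_derive_continuous R_AbsRing R_NormedModule). now auto_derive.
    + intros t Ht. now apply rel_integrand_mid. }
assert (Hpi4 := PI_4).
assert (I5 : - (0.002 * h ^ 9) <= RInt f e PI).
{ set (E := exp (- (1 / e))).
  assert (HE : 0 < E) by apply exp_pos.
  pose proof (exp_far_small h Hh Eh) as HE'. fold E in HE'.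
  set (G := fun t => - (4.3 / e * E) * t).
  apply Rle_trans with (G PI - G e).
  - unfold G. assert (0 < / e * E) by (apply Rmult_lt_0_compat; [apply Rinv_0_lt_compat|]; lra).
    assert (0 <= / e * E * e) by (apply Rmult_le_pos; lra).
    assert (/ e * E * PI <= / e * E * 4) by (apply Rmult_le_compat_l; lra).
    unfold Rdiv in *. lra.
  - apply (RInt_ge_antiderivative _ _ (fun t => - (4.3 / e * E))).
    + lra.
    + apply ex_RInt_rel.
    + intros t. unfold G. auto_derive; [easy|]. ring.
    + intros t. apply continuous_const.
    + intros t Ht. now apply rel_integrand_far. }
assert (HR : 0 < RInt f 0 PI).
{ rewrite <- (@RInt_Chasles R_CompleteNormedModule f 0 e PI),
    <- (@RInt_Chasles R_CompleteNormedModule f 0 (e / 2) e),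
    <- (@RInt_Chasles R_CompleteNormedModule f 0 a2 (e / 2)),
    <- (@RInt_Chasles R_CompleteNormedModule f 0 a1 a2) by apply ex_RInt_rel.
  unfold plus; simpl. lra. }
rewrite (RInt_ext _ (fun t => scal (exp (total_logmod r K 0) * (1 - r)) (f t))).
2:{ intros t _. now apply limit_integrand_rel. }
rewrite (@RInt_scal R_CompleteNormedModule) by apply ex_RInt_rel.
unfold scal; simpl; unfold mult; simpl. apply Rmult_lt_0_compat; [apply norm_pos|exact HR].
Qed.

End Positivity.

(** * Existence of the saddle point *)

Lemma sum1_extend (f : nat -> R) (K k : nat) : (k <= K)%nat ->
  (forall m, (1 <= m)%nat -> 0 <= f m) -> sum1 f k <= sum1 f K.
Proof.
intros H Hf. induction H as [|K H IH]; [lra|].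
simpl. pose proof (Hf (S K) ltac:(lia)). lra.
Qed.

Lemma pow_bernoulli (r : R) (m : nat) : 0 <= r <= 1 -> 1 - INR m * (1 - r) <= r ^ m.
Proof.
intros Hr. induction m as [|m IH]; [simpl; lra|].
rewrite S_INR. simpl. pose proof (pos_INR m).
assert (r * (1 - INR m * (1 - r)) <= r * r ^ m) by (apply Rmult_le_compat_l; lra).
assert (0 <= INR m * ((1 - r) * (1 - r))) by (apply Rmult_le_pos; nra). lra.
Qed.

Lemma slope_nonneg (r : R) (m : nat) : 0 < r < 1 -> (1 <= m)%nat -> 2 * INR m * r ^ m <= slope r m.
Proof.
intros Hr Hm. unfold slope. pose proof (pow_range r m Hr Hm) as Hp. pose proof (pos_INR m).
set (p := r ^ m) in *.
assert (0 <= INR m * p) by nra. assert (0 < 1 - p ^ 2 <= 1) by nra.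
apply (Rmult_le_reg_r (1 - p ^ 2)); [lra|].
replace (2 * INR m * p / (1 - p ^ 2) * (1 - p ^ 2)) with (2 * INR m * p) by (field; lra). nra.
Qed.

Lemma sum_slope_large (N K : nat) : (1 <= N)%nat -> (N <= K)%nat ->
  INR N * (INR N + 2) / 3 <= sum1 (slope (radius (/ INR N))) K.
Proof.
intros HN HK. assert (HN1 : 1 <= INR N) by (apply (le_INR 1); lia).
assert (He : 0 < / INR N) by (apply Rinv_0_lt_compat; lra).
pose proof (radius_range _ He) as Hr.
apply Rle_trans with (sum1 (slope (radius (/ INR N))) N).
2:{ apply sum1_extend; [easy|]. intros m Hm. eapply Rle_trans; [|now apply slope_nonneg].
    assert (0 <= radius (/ INR N) ^ m) by (apply pow_le; lra). pose proof (pos_INR m).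
    apply Rmult_le_pos; lra. }
apply Rle_trans with (sum1 (fun m => 2 * INR m * (1 - INR m / (INR N + 1))) N).
- assert (E : forall k, sum1 (fun m => 2 * INR m * (1 - INR m / (INR N + 1))) k =
    INR k * (INR k + 1) - INR k * (INR k + 1) * (2 * INR k + 1) / (3 * (INR N + 1))).
  { induction k as [|k IH]; [simpl; field; lra|]. cbn [sum1]. rewrite IH, S_INR. field. lra. }
  rewrite E. right. field. lra.
- apply sum1_le. intros m Hm. eapply Rle_trans; [|now apply slope_nonneg].
  pose proof (pos_INR m). apply Rmult_le_compat_l; [lra|].
  replace (1 - INR m / (INR N + 1)) with (1 - INR m * (1 - radius (/ INR N)))
    by (unfold radius; field; lra).
  apply pow_bernoulli. lra.
Qed.

(** Intermediate values: at e = 1 / N the left side is at least N (N + 2) / 3 - N > N; at e = 1/34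
    it is at most 2958 - 34 < 3000. The lower end 1 / N also controls how large K must be. *)
Lemma saddle_exists (N K : nat) : (3000 <= INR N) -> (N <= K)%nat ->
  exists e, / INR N <= e <= / 34 /\ sum1 (slope (radius e)) K - / e = INR N.
Proof.
intros HN HK.
assert (HN0 : (1 <= N)%nat) by (apply INR_le; simpl; lra).
set (g := fun e => INR N - (sum1 (fun m => slope (radius e) m) K - / e)).
assert (Hinv : 0 < / INR N <= / 3000).
{ split; [apply Rinv_0_lt_compat|apply Rinv_le_contravar]; lra. }
destruct (IVT_interv g (/ INR N) (/ 34)) as [e [He E]].
- intros e He1. apply continuity_pt_filterlim.
  unfold g.
  apply (@continuous_minus R_UniformSpace R_AbsRing R_NormedModule (fun _ => INR N)
          (fun e => sum1 (fun m => slope (radius e) m) K - / e)); [apply continuous_const|].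
  apply (@continuous_minus R_UniformSpace R_AbsRing R_NormedModule
          (fun e => sum1 (fun m => slope (radius e) m) K) (fun e => / e)).
  + apply (continuous_sum1 (fun m e => slope (radius e) m)). intros m Hm.
    apply (@ex_derive_continuous R_AbsRing R_NormedModule).
    pose proof (radius_range e ltac:(lra)) as Hr. pose proof (pow_range _ m Hr Hm) as Hp.
    unfold slope, radius in *. auto_derive.
    split; [lra|]. split; [lra|]. split; [|easy].
    set (p := (/ (1 + e)) ^ m) in *. nra.
  + apply (@ex_derive_continuous R_AbsRing R_NormedModule). auto_derive. lra.
- lra.
- unfold g. rewrite Rinv_inv. pose proof (sum_slope_large N K HN0 HK) as H.
  change (fun m => slope (radius (/ INR N)) m) with (slope (radius (/ INR N))). nra.
- unfold g. pose proof (sum_slope_le (/ 34) ltac:(lra) K) as H.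
  change (fun m => slope (radius (/ 34)) m) with (slope (radius (/ 34))).
  assert (2 * ((1 + / 34) / (/ 34) ^ 2) + (1 + / 34 / 2) / / 34 * / (2 * / 34 + (/ 34) ^ 2) = 2958) by field.
  lra.
- exists e. split; [easy|]. unfold g in E. change (sum1 (fun m => slope (radius e) m) K) with (sum1 (slope (radius e)) K) in E. lra.
Qed.

Lemma log_concave_large (b : nat -> nat -> nat) (M K : nat) :
  (forall j, b 0%nat j = if (j =? 0)%nat then 1%nat else 0%nat) ->
  (forall K j, b (S K) j =
    (b K j + if (S K <=? j)%nat then b K (j - S K) + b (S K) (j - S K) else 0)%nat) ->
  3000 <= INR (S (S M)) -> INR (S (S M)) ^ 4 <= INR (S K) ->
  (INR (b (S K) (S M)) - INR (b (S K) M)) * (INR (b (S K) (S (S (S M)))) - INR (b (S K) (S (S M)))) <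
  (INR (b (S K) (S (S M))) - INR (b (S K) (S M))) ^ 2.
Proof.
intros b0 bS HN HK. set (N := S (S M)) in *.
assert (HNK : (N <= S K)%nat).
{ apply INR_le. apply Rle_trans with (INR N ^ 4); [|easy].
  replace (INR N) with (INR N ^ 1) at 1 by ring. apply Rle_pow; [lra|lia]. }
destruct (saddle_exists N (S K) HN HNK) as [e [He Hs]].
assert (Hinv : 0 < / INR N) by (apply Rinv_0_lt_compat; lra).
pose proof (radius_range e ltac:(lra)) as Hr.
apply (log_concave_of_integral_pos b b0 bS (radius e)); [easy|].
apply integral_pos; [lra|exact Hs|].
(* The tail condition: (1 + e)^k >= k e by Bernoulli, and k e^3 >= N (N e)^3 >= 3000 because k >=
   N^4 and N e >= 1. *)
set (k := S K) in *.
assert (HNe : 1 <= INR N * e).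
{ apply (Rmult_le_reg_l (/ INR N)); [easy|]. rewrite <- Rmult_assoc, Rinv_l by lra. lra. }
assert (Hk : 3000 <= INR k * e ^ 3).
{ apply Rle_trans with (INR N ^ 4 * e ^ 3).
  - replace (INR N ^ 4 * e ^ 3) with (INR N * (INR N * e) ^ 3) by ring.
    assert (1 <= (INR N * e) ^ 3) by now apply pow_R1_Rle. nra.
  - apply Rmult_le_compat_r; [apply pow_le; lra|easy]. }
assert (Hp : INR k * e <= (1 + e) ^ k) by (pose proof (poly k e ltac:(lra)); lra).
assert (He3 : 0 < e ^ 3) by (apply pow_lt; lra).
unfold radius. rewrite pow_inv. set (p := (1 + e) ^ k) in *.
assert (Hp0 : 0 < p) by (apply pow_lt; lra).
replace (6 * / p / (1 - / (1 + e)) ^ 2) with (6 * (1 + e) ^ 2 / (p * e ^ 2)) by (field; lra).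
assert (Hpe : 3000 <= p * e ^ 2).
{ apply Rle_trans with (INR k * e * e ^ 2); [lra|]. apply Rmult_le_compat_r; [nra|easy]. }
apply (Rmult_le_reg_r (p * e ^ 2)); [lra|].
unfold Rdiv. rewrite Rmult_assoc, Rinv_l, Rmult_1_r by lra. nra.
Qed.

Lemma log_concave_large_Z (b : nat -> nat -> nat) (M K : nat) :
  (forall j, b 0%nat j = if (j =? 0)%nat then 1%nat else 0%nat) ->
  (forall K j, b (S K) j =
    (b K j + if (S K <=? j)%nat then b K (j - S K) + b (S K) (j - S K) else 0)%nat) ->
  let N := S (S M) in
  (3000 <= Z.of_nat N)%Z -> (N * N * (N * N) <= S K)%nat ->
  ((Z.of_nat (b (S K) (S M)) - Z.of_nat (b (S K) M)) *
   (Z.of_nat (b (S K) (S N)) - Z.of_nat (b (S K) N)) <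
   (Z.of_nat (b (S K) N) - Z.of_nat (b (S K) (S M))) ^ 2)%Z.
Proof.
intros b0 bS N HN HK. apply lt_IZR.
change 2%Z with (Z.of_nat 2). rewrite mult_IZR, <- pow_IZR, !minus_IZR, <- !INR_IZR_INZ.
apply log_concave_large; try easy; fold N.
- rewrite INR_IZR_INZ. now apply IZR_le.
- apply le_INR in HK. rewrite !mult_INR in HK.
  replace (INR N ^ 4) with (INR N * INR N * (INR N * INR N)) by ring. exact HK.
Qed.

Close Scope R_scope.

(** * Numerical verification for small n *)

Section Computation.

Local Open Scope Z_scope.

(* l_0 - l_g + l_(g + (g + 2)) - ..., at most [f] terms: the gaps between squares grow by 2. *)
Fixpoint alternating (f g : nat) (l : list Z) : Z :=
  match f, l with
  | S f', x :: _ => x - alternating f' (S (S g)) (skipn g l)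
  | _, _ => 0
  end.

(* The list holds pbar (n - 1), ..., pbar 0; 60 terms suffice for n < 61^2. *)
Definition next_pbar (l : list Z) : Z := 2 * alternating 60 3 l.

Fixpoint extend (m : nat) (l : list Z) : list Z :=
  match m with O => l | S m' => extend m' (next_pbar l :: l) end.

(* Multiplying only the leading bits keeps the verification fast. *)
Definition sq_gt_test (x y z : Z) : bool :=
  let s := Z.log2 y - 45 in
  if s <=? 0 then x * z <? y * y
  else (0 <=? x) && (0 <=? z) &&
       ((Z.shiftr x s + 1) * (Z.shiftr z s + 1) <=? Z.shiftr y s * Z.shiftr y s).

Fixpoint log_concave_test (m : nat) (l : list Z) : bool :=
  match m with
  | O => true
  | S m' =>
    let x := next_pbar l in
    match l with
    | a :: b :: c :: _ =>
        if sq_gt_test (b - c) (a - b) (x - a) then log_concave_test m' (x :: l) else false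
    | _ => false
    end
  end.

Lemma sq_gt_test_sound (x y z : Z) : sq_gt_test x y z = true -> x * z < y * y.
Proof.
unfold sq_gt_test. destruct (Z.leb_spec (Z.log2 y - 45) 0) as [H|H]; [apply Z.ltb_lt|].
set (s := Z.log2 y - 45) in *. rewrite !Bool.andb_true_iff, !Z.leb_le.
intros [[Hx Hz] HT].
assert (Hp : 0 < 2 ^ s) by (apply Z.pow_pos_nonneg; lia).
rewrite !Z.shiftr_div_pow2 in HT by lia. set (p := 2 ^ s) in *.
pose proof (Z.mul_succ_div_gt x p Hp). pose proof (Z.mul_succ_div_gt z p Hp).
pose proof (Z.mul_div_le y p Hp).
assert (Hy : 0 < y).
{ destruct (Z.le_gt_cases y 0) as [Hy|Hy]; [|easy]. pose proof (Z.log2_nonpos y Hy). lia. }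
assert (0 <= y / p) by (apply Z.div_pos; lia).
set (u := x / p) in *. set (v := z / p) in *. set (w := y / p) in *.
assert (x * z < (p * (u + 1)) * (p * (v + 1))) by (apply Z.mul_lt_mono_nonneg; lia).
assert ((p * w) * (p * w) <= y * y) by (apply Z.mul_le_mono_nonneg; lia).
assert (p * p * ((u + 1) * (v + 1)) <= p * p * (w * w)) by (apply Z.mul_le_mono_nonneg_l; lia).
lia.
Qed.

(** Extending by 9 gives pbar 9, ..., pbar 0, so the first test is the case n = 8; 2991 tests reach
    n = 2998. *)
Lemma log_concave_test_3000 : log_concave_test 2991 (extend 9 (1 :: nil)) = true.
Proof. vm_cast_no_check (eq_refl true). Qed.

End Computation.

Require Import Defs.
From mathcomp Require Import all_boot all_order all_algebra.
From mathcomp Require Import ring zify ssrZ.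

Set Implicit Arguments.
Unset Strict Implicit.
Unset Printing Implicit Defensive.

Import GRing.Theory.

(** * Counting overpartitions *)

(* Overpartitions with parts at most k in which k is not overlined: the condition met by what
   follows a part k. *)
Fixpoint capped (k : nat) (s : seq (nat * bool)) : bool :=
  if s is x :: s' then [&& 0 < x.1, x.1 <= k, x.2 ==> (x.1 != k) & capped x.1 s'] else true.

(* [p] lists the parts that precede [s]. *)
Definition overlined_once (p : seq nat) (s : seq (nat * bool)) : bool :=
  all (fun i => (nth (0, false) s i).2 ==>
                (nth 0 (parts s) i \notin p ++ take i (parts s)))
      (iota 0 (size s)).

Lemma overlined_once_cons p x s :
  overlined_once p (x :: s) = (x.2 ==> (x.1 \notin p)) && overlined_once (rcons p x.1) s.
Proof.
rewrite /overlined_once /= cats0; congr (_ && _).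
rewrite -[1]addn0 iotaDl all_map; apply: eq_all => i /=.
by rewrite cat_rcons.
Qed.

(** Since parts do not increase, y <= x occurs among the preceding parts exactly when y = x. So the
    first-occurrence condition only concerns neighbouring parts. *)
Lemma capped_path x s p : x \in p -> all (leq x) p ->
  [&& path geq x (parts s), all (leq 1) (parts s) & overlined_once p s] = capped x s.
Proof.
elim: s x p => [|[y c] s IH] x p xp allp //=.
rewrite overlined_once_cons /=.
case: (leqP y x) => [yx|]; last by rewrite !andbF.
have yp : (y \notin p) = (y != x).
  congr (~~ _); apply/idP/eqP => [yp|->//].
  by apply/eqP; rewrite eqn_leq yx (allP allp _ yp).
rewrite -(IH y (rcons p y)); first last.
- rewrite all_rcons leqnn /=; apply/allP => z /(allP allp); exact: leq_trans.
- by rewrite mem_rcons inE eqxx.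
rewrite yp /=; case: (0 < y); rewrite ?andbF //=.
by case: (_ ==> _); rewrite ?andbF.
Qed.

(** The cap n + 1 forbids nothing: no part of an overpartition of n reaches it. *)
Lemma is_overpartition_capped n s :
  is_overpartition n s = capped n.+1 s && (sumn (parts s) == n).
Proof.
rewrite /is_overpartition /is_partition; change (all _ (iota 0 _)) with (overlined_once [::] s).
case: s => [|[y c] s]; first by rewrite /= andbT.
rewrite overlined_once_cons /=.
rewrite (_ : capped y s = [&& path geq y (parts s), all (leq 1) (parts s) & overlined_once [:: y] s]);
  last by rewrite (@capped_path y s [:: y]) //= ?inE // leqnn.
case: eqP => [E|]; last by rewrite !andbF.
have yn : y < n.+1 by rewrite ltnS -E leq_addr.
rewrite (ltnW yn) (ltn_eqF yn) !implybT /= !andbT.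
case: (0 < y); rewrite ?andbF //=.
by rewrite andbA.
Qed.

(* The fuel [f] has to exceed [k + n]. *)
Fixpoint capped_enum (f k n : nat) : seq (seq (nat * bool)) :=
  if f is f'.+1 then
    if k is k'.+1 then
      capped_enum f' k' n
      ++ (if (0 < k') && (k' <= n) then map (cons (k', true)) (capped_enum f' k' (n - k')) else [::])
      ++ (if k <= n then map (cons (k, false)) (capped_enum f' k (n - k)) else [::])
    else if n == 0 then [:: [::]] else [::]
  else [::].

Lemma capped_enumS f k n : capped_enum f.+1 k.+1 n =
  capped_enum f k n
  ++ (if (0 < k) && (k <= n) then map (cons (k, true)) (capped_enum f k (n - k)) else [::])
  ++ (if k < n then map (cons (k.+1, false)) (capped_enum f k.+1 (n - k.+1)) else [::]).
Proof. by []. Qed.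

(** Raising the cap from k to k + 1 newly admits a leading overlined k, followed by a tail with cap
    k, and a leading plain k + 1. These are the lists concatenated in [capped_enum]. *)
Lemma cappedS k s : capped k.+1 s =
  capped k s || (if s is x :: s' then
     ((x == (k, true)) && (0 < k) && capped k s') || ((x == (k.+1, false)) && capped k.+1 s')
   else false).
Proof.
case: s => [|[y c] s] //=; rewrite !xpair_eqE.
case: (ltngtP y k) => [yk|yk|->] /=.
- by rewrite (leqW (ltnW yk)) (ltn_eqF (leqW yk)) /= !implybT !orbF.
- case: (ltngtP y k.+1) => [|ky|->] /=; first by rewrite ltnS leqNgt yk.
    by rewrite !andbF.
  by case: c; rewrite ?andbF //= leqnn.
rewrite leqnSn (ltn_eqF (ltnSn k)) /= orbF implybT implybF.
by case: c; case: (0 < k) => //=; rewrite ?orbF.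
Qed.

Lemma mem_capped_enum f k n s : k + n < f ->
  (s \in capped_enum f k n) = capped k s && (sumn (parts s) == n).
Proof.
elim: f k n s => // f IH [|k] n s; rewrite ltnS => kn.
  rewrite add0n in kn; rewrite /=; case: s => [|[y c] s] /=.
    by case: n {kn}.
  by case: n {kn} => [|n]; rewrite ?inE //; case: y.
rewrite capped_enumS !mem_cat cappedS IH //.
rewrite andb_orl; congr (_ || _).
set A := (X in _ \in X); set B := (X in (_ || (_ \in X))).
have HA : (s \in A) = (if s is x :: s' then (x == (k, true)) && (0 < k) && capped k s' else false)
    && (sumn (parts s) == n).
  rewrite /A; case: ifP => [/andP[k0 kn']|kn'].
    apply/mapP/idP => [[t]|].
      rewrite IH; last by rewrite subnKC //; apply: leq_ltn_trans kn; apply: leq_addl.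
      move=> /andP[Ht /eqP Hs] -> /=; rewrite eqxx k0 Ht Hs /=.
      by rewrite -(eqn_add2l 0) subnKC.
    case: s => [|x s] //= /andP[/andP[/andP[/eqP-> _] Ht] /eqP Hs].
    exists s => //; rewrite IH; last by rewrite subnKC //; apply: leq_ltn_trans kn; apply: leq_addl.
    by rewrite Ht -Hs /= addKn eqxx.
  rewrite in_nil; case: s => [|x s] //=; apply/esym/negP.
  move=> /andP[/andP[/andP[/eqP-> k0] _]] /= /eqP Hs.
  by rewrite k0 /= -Hs leq_addr in kn'.
have HB : (s \in B) = (if s is x :: s' then (x == (k.+1, false)) && capped k.+1 s' else false)
    && (sumn (parts s) == n).
  clear HA; rewrite /B; case: ifP => kn'.
    have lt : k.+1 + (n - k.+1) < f by rewrite subnKC //; apply: leq_trans kn; rewrite addSn ltnS leq_addl.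
    apply/mapP/idP => [[t]|].
      rewrite IH // => /andP[Ht /eqP Hs] -> /=; rewrite eqxx Ht Hs /=.
      by rewrite -(eqn_add2l 0) subnKC.
    case: s => [|x s] //= /andP[/andP[/eqP-> Ht] /eqP Hs].
    exists s => //; rewrite IH //.
    by rewrite Ht -Hs /= addKn eqxx.
  rewrite in_nil; case: s => [|x s] //=; apply/esym/negP.
  move=> /andP[/andP[/eqP-> _]] /= /eqP Hs.
  by rewrite -Hs leq_addr in kn'.
by rewrite HA HB -andb_orl; clear HA HB; case: s.
Qed.

Lemma uniq_capped_enum f k n : k + n < f -> uniq (capped_enum f k n).
Proof.
elim: f k n => // f IH [|k] n; rewrite ltnS => kn; first by case: n {kn}.
rewrite capped_enumS !cat_uniq IH //=.
have cons_inj (x : nat * bool) : injective (cons x) by move=> s t [].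
have Hm s : s \in capped_enum f k n -> capped k s by rewrite mem_capped_enum // => /andP[].
have lt1 : k <= n -> k + (n - k) < f.
  by move=> h; rewrite subnKC //; apply: leq_ltn_trans kn; apply: leq_addl.
have lt2 : k < n -> k.+1 + (n - k.+1) < f.
  by move=> h; rewrite subnKC //; apply: leq_trans kn; rewrite addSn ltnS leq_addl.
apply/and4P; split.
- rewrite has_cat negb_or; apply/andP; split.
    case: ifP => // _; apply/hasPn => s /mapP[t _ ->]; apply/negP => /Hm /=.
    by rewrite eqxx /= !andbF.
  case: ifP => // _; apply/hasPn => s /mapP[t _ ->]; apply/negP => /Hm /=.
  by rewrite ltnn.
- by case: ifP => // /andP[_ h]; rewrite map_inj_uniq // IH // lt1.
- apply/hasPn => s Hs; apply/negP; move: Hs.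
  by case: ifP => // _ /mapP[t _ ->]; case: ifP => // _ /mapP[u _ []].
by case: ifP => // h; rewrite map_inj_uniq // IH // lt2.
Qed.

Lemma pbar_enum n : pbar n = size (capped_enum (n.+1 + n).+1 n.+1 n).
Proof.
rewrite /pbar cardE -(size_map (fun s : n.-bseq _ => ord_forget s)).
apply: perm_size; apply: uniq_perm.
- rewrite map_inj_uniq ?enum_uniq // => s t /ord_forget_inj; exact: val_inj.
- exact: uniq_capped_enum.
move=> s; rewrite mem_capped_enum // -is_overpartition_capped.
apply/mapP/idP => [[t]|Hs]; first by rewrite mem_enum inE => Ht ->.
by have [t Ht Et] := is_overpartition_bounded Hs; exists t; rewrite ?mem_enum.
Qed.

Definition capped_count (k n : nat) : nat := size (capped_enum (k + n).+1 k n).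

Lemma size_capped_enum f k n : k + n < f -> size (capped_enum f k n) = capped_count k n.
Proof.
move=> kn; apply: perm_size; apply: uniq_perm; rewrite ?uniq_capped_enum //.
by move=> s; rewrite !mem_capped_enum.
Qed.

(* Overpartitions of n with parts at most k. *)
Definition bounded_count (k n : nat) : nat :=
  capped_count k n + (if (0 < k) && (k <= n) then capped_count k (n - k) else 0).

Lemma bounded_count0 n : bounded_count 0 n = (n == 0).
Proof. by rewrite /bounded_count /capped_count addn0; case: n. Qed.

Lemma capped_countS k n : capped_count k.+1 n =
  bounded_count k n + (if k < n then capped_count k.+1 (n - k.+1) else 0).
Proof.
rewrite /bounded_count {1}/capped_count capped_enumS !size_cat size_capped_enum ?addSn //.
rewrite -addnA; congr (_ + (_ + _)); case: ifP => // h; rewrite size_map size_capped_enum //; lia.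
Qed.

(** If C_k and B_k are the generating functions of [capped_count] and [bounded_count], then (1 -
    q^(k+1)) C_(k+1) = B_k and B_(k+1) = (1 + q^(k+1)) C_(k+1). Eliminating C_(k+1) gives the
    recursion [b_S]. *)
Lemma bounded_countS k n : bounded_count k.+1 n = bounded_count k n +
  (if k < n then bounded_count k (n - k.+1) + bounded_count k.+1 (n - k.+1) else 0).
Proof.
rewrite {1}/bounded_count capped_countS /=; case: ifP => // kn; last by rewrite !addn0.
set j := n - k.+1.
have -> : bounded_count k.+1 j = capped_count k.+1 j + (if k < j then capped_count k.+1 (j - k.+1) else 0).
  by [].
have := capped_countS k j; set x := (if _ then _ else _); lia.
Qed.

Lemma bounded_count_pbar k n : n <= k -> bounded_count k n = pbar n.
Proof.
move=> nk; rewrite -(subnKC nk); elim: (k - n) => [|d IH].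
  by rewrite addn0 pbar_enum size_capped_enum // capped_countS ltnn addn0.
by rewrite addnS bounded_countS IH ltnNge leq_addr addn0.
Qed.

(** * Finite form of Gauss's theta identity and the recurrence for pbar *)

Section Theta.

Local Open Scope ring_scope.

Variable R : comNzRingType.
Implicit Types p q : {poly R}.

Definition eq_below (L : nat) p q := forall i, (i < L)%N -> p`_i = q`_i.

Lemma eq_below_trans L p q s : eq_below L p q -> eq_below L q s -> eq_below L p s.
Proof. by move=> h1 h2 i iL; rewrite h1 // h2. Qed.

Lemma eq_below_mull L s p q : eq_below L p q -> eq_below L (s * p) (s * q).
Proof.
move=> h i iL; rewrite !coefM; apply: eq_bigr => j _; rewrite h //.
by apply: leq_ltn_trans iL; rewrite leq_subr.
Qed.

Definition distinct_prod (n : nat) : {poly R} := \prod_(0 <= i < n) (1 + 'X^(i.+1)).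
Definition euler_prod (s n : nat) : {poly R} := \prod_(s <= i < n) (1 - 'X^(i.+1)).

(** Each factor 1 - q^(i+1) is invertible modulo q^L. *)
Lemma euler_prod_cancel L n p :
  eq_below L (euler_prod 0 n * p) 0 -> eq_below L p 0.
Proof.
elim: n p => [|n IH] p; first by rewrite /euler_prod big_nil mul1r.
rewrite /euler_prod big_nat_recr //= -mulrA => /IH h.
elim/ltn_ind => i IHi iL; have := h i iL.
rewrite mulrBl mul1r coefB coefXnM coef0.
case: ltnP => [_|ni]; first by rewrite subr0.
rewrite (IHi (i - n.+1)%N); first by rewrite coef0 subr0.
- by rewrite ltn_subrL; apply: leq_trans ni.
- by apply: leq_ltn_trans iL; rewrite leq_subr.
Qed.

Definition theta_poly (n : nat) : {poly R} :=
  1 + \sum_(0 <= k < n) (-1) ^+ k.+1 * 2%:R * 'X^(k.+1 ^ 2).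

(* Modulo q^(n+1) this is Gauss's identity \sum_k (-1)^k q^(k^2) = \prod_m (1 - q^m) / (1 + q^m).
   The induction on n works because the summands telescope. *)
Lemma theta_finite n : distinct_prod n * theta_poly n = euler_prod 0 n +
  \sum_(0 <= s < n) (-1) ^+ s.+1 * 2%:R * 'X^(s.+1 * n.+1) * distinct_prod s * euler_prod s.+1 n.
Proof.
elim: n => [|n IH].
  by rewrite /distinct_prod /euler_prod /theta_poly !big_nil; ring.
(* Replacing n by n + 1 in the sum costs the telescoping w n - w 0. The term w 0 turns (1 + q^(n+1))
   [euler_prod 0 n] into [euler_prod 0 n.+1], and w n combines with the new theta term to give the
   summand s = n. *)
pose w s : {poly R} := (-1) ^+ s * 2%:R * 'X^(s.+1 * n.+1) * distinct_prod s * euler_prod s n.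
have step s : (0 <= s < n)%N ->
    (-1) ^+ s.+1 * 2%:R * 'X^(s.+1 * n.+2) * distinct_prod s * euler_prod s.+1 n.+1 =
    (1 + 'X^(n.+1)) * ((-1) ^+ s.+1 * 2%:R * 'X^(s.+1 * n.+1) * distinct_prod s * euler_prod s.+1 n)
    - (w s.+1 - w s).
  move=> /= sn; rewrite /w.
  have -> : euler_prod s n = (1 - 'X^(s.+1)) * euler_prod s.+1 n by rewrite /euler_prod big_ltn.
  have -> : euler_prod s.+1 n.+1 = euler_prod s.+1 n * (1 - 'X^(n.+1)).
    by rewrite /euler_prod big_nat_recr.
  have -> : distinct_prod s.+1 = distinct_prod s * (1 + 'X^(s.+1)).
    by rewrite /distinct_prod big_nat_recr.
  rewrite (_ : (s.+1 * n.+2 = s.+1 * n.+1 + s.+1)%N); last by lia.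
  rewrite (_ : (s.+2 * n.+1 = s.+1 * n.+1 + n.+1)%N); last by lia.
  rewrite !exprD !exprS; ring.
rewrite /theta_poly big_nat_recr //= addrA -/(theta_poly n).
have EA : distinct_prod n.+1 = distinct_prod n * (1 + 'X^(n.+1)).
  by rewrite /distinct_prod big_nat_recr.
have EB : euler_prod 0 n.+1 = euler_prod 0 n * (1 - 'X^(n.+1)).
  by rewrite /euler_prod big_nat_recr.
rewrite mulrDr {1}EA mulrAC IH big_nat_recr //= (eq_big_nat _ _ step).
rewrite sumrB telescope_sumr // -mulr_sumr EA EB.
have -> : euler_prod n.+1 n.+1 = 1 by rewrite /euler_prod big_geq.
have -> : w 0 = 2%:R * 'X^(n.+1) * euler_prod 0 n.
  by rewrite /w /distinct_prod big_nil mul1n; ring.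
have -> : w n = (-1) ^+ n * 2%:R * 'X^(n.+1 ^ 2) * distinct_prod n.
  by rewrite /w /euler_prod big_geq // mulr1.
set T := \sum_(0 <= s < n) _.
rewrite (_ : (n.+1 * n.+2 = n.+1 ^ 2 + n.+1)%N); last by lia.
rewrite !exprD [(-1) ^+ n.+1]exprS; ring.
Qed.

Definition count_poly (L k : nat) : {poly R} := \poly_(j < L) (bounded_count k j)%:R.

Lemma count_poly_step L k :
  eq_below L ((1 - 'X^(k.+1)) * count_poly L k.+1) ((1 + 'X^(k.+1)) * count_poly L k).
Proof.
move=> i iL; rewrite mulrBl mulrDl !mul1r coefB coefD !coefXnM !coef_poly iL.
have iL' : (i - k.+1 < L)%N by apply: leq_ltn_trans iL; rewrite leq_subr.
rewrite iL' bounded_countS ltnS; case: leqP => ik; first by rewrite subr0 addr0 addn0.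
by rewrite !natrD; ring.
Qed.

Lemma count_poly_euler L k : eq_below L (euler_prod 0 k * count_poly L k) (distinct_prod k).
Proof.
elim: k => [|k IH].
  move=> i iL; rewrite /euler_prod /distinct_prod !big_nil mul1r coef_poly iL coef1.
  by rewrite bounded_count0.
rewrite /euler_prod big_nat_recr //= -mulrA -/(euler_prod 0 k).
apply: (@eq_below_trans _ _ (euler_prod 0 k * ((1 + 'X^(k.+1)) * count_poly L k))).
  by apply: eq_below_mull; exact: count_poly_step.
rewrite mulrCA /distinct_prod big_nat_recr //= -/(distinct_prod k) [X in eq_below _ _ X]mulrC.
exact: eq_below_mull.
Qed.

(** After multiplication by [euler_prod 0 n], the product becomes [distinct_prod n * theta_poly n];
    in [theta_finite] every summand beyond [euler_prod 0 n] is divisible by q^(n+1). *)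
Lemma count_poly_theta n : eq_below n.+1 (count_poly n.+1 n * theta_poly n) 1.
Proof.
suff H : eq_below n.+1 (count_poly n.+1 n * theta_poly n - 1) 0.
  by move=> i iL; apply/eqP; rewrite -subr_eq0 -coefB H // coef0.
apply: (@euler_prod_cancel _ n) => i iL.
rewrite mulrBr mulr1 coefB.
have -> : euler_prod 0 n * (count_poly n.+1 n * theta_poly n) =
  theta_poly n * (euler_prod 0 n * count_poly n.+1 n) by ring.
rewrite (eq_below_mull _ (@count_poly_euler n.+1 n) iL) mulrC theta_finite coefD addrC addKr.
rewrite coef_sum coef0 big_nat_cond big1 // => s /andP[/andP[_ sn] _].
have -> : (-1) ^+ s.+1 * 2%:R * 'X^(s.+1 * n.+1) * distinct_prod s * euler_prod s.+1 n =
  'X^(s.+1 * n.+1) * ((-1) ^+ s.+1 * 2%:R * distinct_prod s * euler_prod s.+1 n) :> {poly R} by ring.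
by rewrite coefXnM (leq_trans iL) // mulSn leq_addr.
Qed.

Lemma theta_recurrence n : (0 < n)%N ->
  (pbar n)%:R = \sum_(0 <= k < n)
    (if (k.+1 ^ 2 <= n)%N then (-1) ^+ k * 2%:R * (pbar (n - k.+1 ^ 2))%:R else 0) :> R.
Proof.
move=> n0; have := count_poly_theta (ltnSn n).
rewrite coef1 gtn_eqF // /theta_poly mulrDr mulr1 coefD coef_poly ltnSn bounded_count_pbar //.
rewrite mulr_sumr coef_sum => /eqP; rewrite addr_eq0 => /eqP ->; rewrite -sumrN.
apply: eq_bigr => k _; rewrite mulrA coefMXn; case: leqP => kn; last by rewrite oppr0.
rewrite -[(-1) ^+ k.+1 * 2%:R]/(_ * _).
have -> : (-1) ^+ k.+1 * 2%:R = ((-1) ^+ k.+1 * 2%:R)%:P :> {poly R}.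
  by rewrite polyCM polyC_exp polyCN !polyC_natr.
rewrite coefMC coef_poly ltnS leq_subr bounded_count_pbar ?leq_subr // exprS; ring.
Qed.

End Theta.

(** * Correctness of the tabulated recurrence and the two ranges of n *)

Definition zpbar (n : nat) : Z := Z.of_nat (pbar n).

Definition pbar_table (n : nat) : seq Z := [seq zpbar (n - i.+1) | i <- iota 0 n].

Lemma pbar_tableS n : pbar_table n.+1 = zpbar n :: pbar_table n.
Proof.
rewrite /pbar_table /= subn1; congr (_ :: _).
by rewrite -[1]addn0 iotaDl -map_comp; apply: eq_map => i /=; rewrite subSS.
Qed.

Lemma nth_pbar_table n i : i < n -> nth 0%R (pbar_table n) i = zpbar (n - i.+1).
Proof. by move=> h; rewrite (nth_map 0) ?size_iota // nth_iota. Qed.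

Lemma skipnE T m (l : seq T) : List.skipn m l = drop m l.
Proof. by elim: m l => [|m IH] [|x l] //=. Qed.

Lemma alternatingS f g x l :
  alternating f.+1 g (x :: l) = (x - alternating f g.+2 (drop g (x :: l)))%R.
Proof. by rewrite -skipnE. Qed.

(** The table starts at pbar (n - 1), so pbar (n - (k+1)^2) sits at index (k+1)^2 - 1; the step to
    the next square is 2 k + 3. *)
Lemma alternating_pbar_table f k n :
  alternating f (2 * k).+3 (drop (k.+1 ^ 2).-1 (pbar_table n)) =
  (\sum_(0 <= i < f)
    if ((k + i).+1 ^ 2 <= n)%N then (-1) ^+ i * zpbar (n - (k + i).+1 ^ 2) else 0)%R.
Proof.
elim: f k => [|f IH] k; first by rewrite big_nil.
have sz : size (pbar_table n) = n by rewrite size_map size_iota.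
case: (leqP (k.+1 ^ 2) n) => kn.
  have lt : (k.+1 ^ 2).-1 < n by rewrite prednK // expn_gt0.
  rewrite (drop_nth 0%R) ?sz // alternatingS -(drop_nth 0%R) ?sz // drop_drop.
  rewrite big_nat_recl // addn0 kn expr0 mul1r nth_pbar_table // prednK ?expn_gt0 //.
  congr (_ + _)%R.
  rewrite (_ : ((2 * k).+3 + (k.+1 ^ 2).-1 = (k.+2 ^ 2).-1)%N); last first.
    by have := expn_gt0 k.+1 2; lia.
  rewrite (_ : (2 * k).+3.+2 = (2 * k.+1).+3); last by lia.
  rewrite IH -sumrN; apply: eq_bigr => i _; rewrite addSnnS.
  by case: ifP => // _; rewrite ?oppr0 // exprS mulN1r mulNr.
rewrite drop_oversize ?sz; last by rewrite -ltnS prednK ?expn_gt0.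
rewrite big1 // => i _; case: ifP => // h; move: kn; rewrite ltnNge.
by rewrite (leq_trans _ h) // leq_exp2r // ltnS leq_addr.
Qed.

Lemma sum_nat_trunc (V : zmodType) (F : nat -> V) m d :
  (forall i, m <= i -> F i = 0%R) ->
  (\sum_(0 <= i < m + d) F i = \sum_(0 <= i < m) F i)%R.
Proof.
move=> F0; rewrite (big_cat_nat _ (n := m)) ?leq_addr //=.
rewrite [X in (_ + X)%R]big_nat_cond [X in (_ + X)%R]big1 ?addr0 //.
by move=> i /andP[/andP[mi _] _]; apply: F0.
Qed.

Lemma next_pbar_table n : 0 < n < 61 ^ 2 -> next_pbar (pbar_table n) = zpbar n.
Proof.
move=> /andP[n0 n61].
have nat_Z m : Z.of_nat m = (m%:R)%R by rewrite -(rmorph_nat Z.of_nat) natn.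
pose F i : Z := (if (i.+1 ^ 2 <= n)%N then (-1) ^+ i * zpbar (n - i.+1 ^ 2) else 0)%R.
have -> : next_pbar (pbar_table n) = (2%:R * \sum_(0 <= i < 60) F i)%R.
  by rewrite /next_pbar -(drop0 (pbar_table n)) (alternating_pbar_table 60 0).
rewrite /zpbar nat_Z (theta_recurrence Z n0).
(* The recurrence has n terms and the program 60. Both sums are padded with zeros to 60 + n terms,
   as squares from 61^2 on exceed n. *)
rewrite -(sum_nat_trunc (m := 60) n); last first.
  move=> i i60; rewrite /F leqNgt (leq_trans n61) // leq_exp2r //.
rewrite addnC (sum_nat_trunc (m := n)); last first.
  move=> i ni; rewrite /F leqNgt (_ : n < _) //.
  by apply: leq_ltn_trans ni _; rewrite expnS expn1 mulSn leq_addr.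
rewrite mulr_sumr; apply: eq_bigr => i _; rewrite /F /zpbar nat_Z.
by case: ifP => // _; ring.
Qed.

Lemma extend_pbar_table m n : 0 < n -> n + m <= 61 ^ 2 ->
  extend m (pbar_table n) = pbar_table (n + m).
Proof.
elim: m n => [|m IH] n n0 nm; first by rewrite addn0.
rewrite /= next_pbar_table ?n0; last by lia.
by rewrite -pbar_tableS IH ?addSnnS.
Qed.

Lemma log_concave_test_sound m n i : 3 < n -> n + m <= 61 ^ 2 ->
  log_concave_test m (pbar_table n) -> n <= i < n + m ->
  ((zpbar i.-2 - zpbar (i - 3)) * (zpbar i - zpbar i.-1) < (zpbar i.-1 - zpbar i.-2) ^+ 2)%R.
Proof.
elim: m n => [|m IH] n n3 nm; first by lia.
have n0 : 0 < n by lia.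
rewrite /= next_pbar_table ?n0; last by lia.
case: n n3 nm {n0} => [|[|[|n]]] // n3 nm.
rewrite !pbar_tableS -!pbar_tableS; case: ifP => // test H.
rewrite leq_eqVlt => /andP[/predU1P[<-|ni] im]; last by apply: IH H _ => //; lia.
by move/sq_gt_test_sound/Z.ltb_spec0: test; rewrite expr2 !subSS subn0.
Qed.

Lemma pbar_log_concave_small n : 8 <= n < 2999 ->
  ((zpbar n - zpbar n.-1) * (zpbar n.+2 - zpbar n.+1) < (zpbar n.+1 - zpbar n) ^+ 2)%R.
Proof.
move=> /andP[n8 n2999].
have p1 : pbar_table 1 = [:: BinNums.Zpos BinNums.xH].
  rewrite pbar_tableS /pbar_table /zpbar /= -(bounded_count_pbar (leqnn 0)) bounded_count0 //.
have := log_concave_test_3000; rewrite -p1 extend_pbar_table // => H.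
have /= := log_concave_test_sound (i := n.+2) _ _ H.
rewrite (_ : n.+2 - 3 = n.-1); last by lia.
by apply => //; lia.
Qed.

Lemma pbar_log_concave_large n : 2999 <= n ->
  ((zpbar n - zpbar n.-1) * (zpbar n.+2 - zpbar n.+1) < (zpbar n.+1 - zpbar n) ^+ 2)%R.
Proof.
case: n => // n n2999.
(* N^4 meets the size condition of [log_concave_large_Z], and it is large enough that
   [bounded_count] agrees with [pbar] at all four indices up to N + 1. *)
pose N := n.+2; pose K := (N * N * (N * N))%N.
have NK : N.+1 <= K.+1 by rewrite ltnS /K (leq_trans (leq_pmulr N (isT : 0 < N))) // leq_pmulr.
have E j : j <= N.+1 -> Z.of_nat (bounded_count K.+1 j) = zpbar j.
  by move=> h; rewrite bounded_count_pbar //; apply: leq_trans NK.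
have b0 j : bounded_count 0 j = if Nat.eqb j 0 then 1 else 0 by rewrite bounded_count0; case: j.
have bS k j : bounded_count k.+1 j = bounded_count k j +
    (if Nat.leb k.+1 j then bounded_count k (j - k.+1) + bounded_count k.+1 (j - k.+1) else 0).
  by rewrite bounded_countS; congr (_ + _); case: Nat.leb_spec => /leP; case: leqP => //; lia.
have hN : BinInt.Z.le 3000 (Z.of_nat N) by lia.
have /Z.ltb_spec0 := log_concave_large_Z bounded_count n K b0 bS hN (elimT leP (leqnSn K)).
rewrite -/N !E //; try by rewrite /N; lia.
by rewrite BinInt.Z.pow_2_r expr2.
Qed.

Theorem theorem2p2 (n : nat) (hn : (8 <= n)%N) :
  ((delta pbar n) ^+ 2 > delta pbar n.-1 * delta pbar n.+1)%R.
Proof.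
have H : ((zpbar n - zpbar n.-1) * (zpbar n.+2 - zpbar n.+1) < (zpbar n.+1 - zpbar n) ^+ 2)%R.
  case: (leqP 2999 n) => h; first exact: pbar_log_concave_large.
  by apply: pbar_log_concave_small; rewrite hn.
move: H; rewrite /delta prednK ?(leq_trans _ hn) // /zpbar !expr2; lia.
Qed.
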